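(* Let $X$ be a Banach space with Pełczyński's property $(u)$ and let $C\in\mathcal{B}(X)$. Then either $C$ is weakly compact, or $C$ contains an $\ell_1$-sequence, or $C$ contains a $c_0$-summing basic sequence.
   Context: $\mathcal{B}(X)$ denotes the family of all nonempty bounded, closed, convex subsets of $X$. Property $(u)$: a Banach space $X$ has Pełczyński's property $(u)$ if for every weak Cauchy sequence $(x_n)$ in $X$ there is a sequence $(y_n)\subset X$ such that (1) $\sum_{n=1}^\infty|x^*(y_n)|<\infty$ for all $x^*\in X^*$, and (2) $\big(x_n-\sum_{i=1}^n y_i\big)_n$ converges weakly to zero. Two sequences $(x_n)$, $(y_n)$ in Banach spaces are equivalent if there is $L\ge1$ such that $\frac1L\|\sum a_ix_i\|\le\|\sum a_iy_i\|\le L\|\sum a_ix_i\|$ for all finitely supported scalar sequences $(a_i)$. An $\ell_1$-sequence is a sequence equivalent to the standard unit vector basis of $\ell_1$. The summing basis of $c_0$ is $s_n=e_1+\dots+e_n$, where $(e_n)$ is the canonical basis of $c_0$ (with the sup norm); a $c_0$-summing basic sequence is a sequence equivalent to $(s_n)$. *)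

(* Defs.v *)
From HB Require Import structures.
From mathcomp Require Import all_boot all_order all_algebra.
From mathcomp Require Import complex.
From mathcomp Require Import all_classical all_reals all_analysis.

Set Implicit Arguments.
Unset Strict Implicit.
Unset Printing Implicit Defensive.

Import Order.TTheory GRing.Theory Num.Theory.
Import numFieldNormedType.Exports.

Local Open Scope classical_set_scope.
Local Open Scope ring_scope.

Variant scalar_kind := RealScalars | ComplexScalars.

Definition scalars (R : realType) (k : scalar_kind) : numFieldType :=
  match k with
  | RealScalars => R
  | ComplexScalars => R[i]
  end.

Definition realpart (R : realType) (k : scalar_kind) : scalars R k -> R :=
  match k return scalars R k -> R with
  | RealScalars => fun a => a
  | ComplexScalars => fun a => complex.Re a
  end.

(* The norm of a normed module over K takes its values in K, as a nonnegative
   element of K; [rnorm] is the same number, as an element of R. *)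
Definition rnorm (R : realType) (k : scalar_kind)
    (V : normedModType (scalars R k)) (x : V) : R :=
  realpart `|x|.

Section Weak.
Context {K : numFieldType} (X : normedModType K).

Definition dual := {f : {linear X -> K^o} | continuous f}.

Definition dual_fun (f : dual) : X -> K^o := sval f.

Definition weak : topologicalType :=
  sup_topology (fun f : dual => Topological.on (initial_topology (dual_fun f))).

Definition weakly_compact (C : set X) := compact (C : set weak).

Definition weakly_cvg (x : nat -> X) (l : X) :=
  (x : nat -> weak) @ \oo --> (l : weak).

Definition weakly_cauchy (x : nat -> X) :=
  forall f : dual, cauchy ((fun n => dual_fun f (x n)) @ \oo).

Definition bounded_closed_convex (C : set X) :=
  [/\ C !=set0, bounded_set C, closed C & @convex_set K X C].

End Weak.

Section Sequences.
Context {R : realType} {k : scalar_kind}.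
Let K := scalars R k.

Definition property_u (X : completeNormedModType K) :=
  forall x : nat -> X, weakly_cauchy x ->
  exists y : nat -> X,
    (forall f : dual X,
        (\sum_(0 <= n <oo) (rnorm (dual_fun f (y n)))%:E < +oo)%E) /\
    weakly_cvg (fun n => x n - \sum_(i < n.+1) y i) 0.

(* Norms are passed as extended-real-valued functions, so that l1 and c0 can be
   treated as spaces of scalar sequences with the norms below, which are finite
   on l1 and c0. A finitely supported scalar sequence is given by [a] together
   with a bound [n] for its support. *)
Definition equivalent_seq (V W : lmodType K) (NV : V -> \bar R)
    (NW : W -> \bar R) (x : nat -> V) (y : nat -> W) :=
  exists2 L : R, 1 <= L &
  forall (n : nat) (a : nat -> K),
    let u := \sum_(i < n) a i *: x i in
    let v := \sum_(i < n) a i *: y i in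
    ((L^-1)%:E * NV u <= NW v /\ NW v <= L%:E * NV u)%E.

Definition l1_norm (u : nat -> K^o) : \bar R :=
  (\sum_(0 <= n <oo) (rnorm (u n))%:E)%E.

Definition sup_norm (u : nat -> K^o) : \bar R :=
  ereal_sup [set (rnorm (u n))%:E | n in [set: nat]].

Definition unit_vector (n : nat) : nat -> K^o := fun j => (j == n)%:R.

Definition summing_vector (n : nat) : nat -> K^o :=
  \sum_(i < n.+1) unit_vector i.

Definition l1_sequence (X : normedModType K) (x : nat -> X) :=
  equivalent_seq (fun v => (rnorm v)%:E) l1_norm x unit_vector.

Definition c0_summing_basic_sequence (X : normedModType K) (x : nat -> X) :=
  equivalent_seq (fun v => (rnorm v)%:E) sup_norm x summing_vector.

End Sequences.

(* Main.v *)
Require Import Defs.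
From HB Require Import structures.
From mathcomp Require Import all_boot all_order all_algebra.
From mathcomp Require Import complex.
From mathcomp Require Import all_classical all_reals all_analysis.
From mathcomp Require Import ring lra zify.

Set Implicit Arguments.
Unset Strict Implicit.
Unset Printing Implicit Defensive.

Import Order.TTheory GRing.Theory Num.Theory.
Import numFieldNormedType.Exports.

Local Open Scope classical_set_scope.
Local Open Scope ring_scope.

(** Suppose that [C] is not weakly compact and contains no l1-sequence; a
   c0-summing basic sequence is found in [C] as follows.

   Lack of weak compactness gives a sequence [x] in [C] and a bounded sequence
   [f] in the dual such that [f j] vanishes at [x i] for [i < j] and is almost 1
   there for [i >= j] (a criterion of James, [james_sequence]). It is built from
   an ultrafilter on [C] without weak limit in [C]: such an ultrafilter stays at a
   positive distance from every finite-dimensional subspace in the sense of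
   [ultra_hull_gap], and separation produces the functionals. Since
   [C] contains no l1-sequence, Rosenthal's theorem ([rosenthal_l1]) lets one
   assume that [x] is weakly Cauchy, and property (u) then gives a weakly
   unconditionally Cauchy series of terms [y l] such that [x n] minus the n-th
   partial sum tends weakly to 0. By Mazur's argument ([small_block]) suitable convex
   combinations [z i] of the [x n] over successive intervals of indices are
   close in norm to the same convex combinations of the partial sums.

   The sequence [z] is the desired one. Put [a l] for the sum of the [b i] over
   [i >= l], so that the norm of the combination of the summing basis with
   coefficients [b] is the maximum of the moduli of the [a l]. The functional [f]
   with index at the start of the j-th interval takes on the combination of the
   [z i] with coefficients [b] a value that differs from [a j] by at most half the
   maximum of these moduli; taking [j] where the maximum is attained gives the lower
   estimate.
   For the upper estimate, the [z i] are replaced by combinations of the [y l];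
   by Abel summation ([abel_bound]) the modulus of the coefficient of each [y l] is
   at most the maximum of the moduli of the [a l], and [wuc_bound], a uniform
   boundedness principle proved by a gliding hump, bounds the norm.

   All functionals except those of the gliding hump come from the Hahn-Banach
   theorem, through the separation of a convex set from a ball around the origin
   ([separation]). Real and complex scalars are treated together: all
   convexity arguments use real parts of functionals, and two real parts
   control a modulus ([second_direction]). *)

(** * Real numbers as scalars and real-valued norms *)

Section Scalars.
Context {R : realType} {k : scalar_kind}.
Local Notation K := (scalars R k).

Definition emb : R -> K :=
  match k return R -> scalars R k with
  | RealScalars => fun r => r
  | ComplexScalars => fun r => real_complex R r
  end.

Lemma emb_monoid_morphism : monoid_morphism emb.
Proof. by rewrite /emb; case: k => //; split=> [|x y]; rewrite ?rmorph1 ?rmorphM. Qed.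

Lemma emb_zmod_morphism : zmod_morphism emb.
Proof. by rewrite /emb; case: k => // x y; rewrite rmorphB. Qed.

HB.instance Definition _ := GRing.isZmodMorphism.Build R K emb emb_zmod_morphism.
HB.instance Definition _ := GRing.isMonoidMorphism.Build R K emb emb_monoid_morphism.

Lemma realpart_zmod_morphism : zmod_morphism (@realpart R k).
Proof. by rewrite /realpart; case: k => // -[a b] [c d]. Qed.

HB.instance Definition _ :=
  GRing.isZmodMorphism.Build K R (@realpart R k) realpart_zmod_morphism.

Lemma embK : cancel emb (@realpart R k).
Proof. by rewrite /emb /realpart; case: k. Qed.

Lemma realpart_embM r (a : K) : realpart (emb r * a) = r * realpart a.
Proof.
rewrite /emb /realpart; case: k a => // -[a b] /=.
by rewrite mul0r subr0.
Qed.

Lemma ler_emb r s : (emb r <= emb s) = (r <= s).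
Proof. by rewrite /emb; case: k => //; exact: lecR. Qed.

Lemma ltr_emb r s : (emb r < emb s) = (r < s).
Proof. by rewrite /emb; case: k => //; exact: ltcR. Qed.

Lemma emb_realpart_ge0 (a : K) : 0 <= a -> emb (realpart a) = a.
Proof.
rewrite /emb /realpart; case: k a => // a a0.
by apply: RRe_real; apply: ger0_real.
Qed.

Lemma norm_emb r : `|emb r| = emb `|r|.
Proof.
have [r0|r0] := leP 0 r; first by rewrite !ger0_norm// -(rmorph0 emb) ler_emb.
by rewrite !ltr0_norm ?rmorphN// -(rmorph0 emb) ltr_emb.
Qed.

End Scalars.

Section RealNorm.
Context {R : realType} {k : scalar_kind}.
Local Notation K := (scalars R k).
Implicit Type V : normedModType K.

Lemma emb_rnorm V (x : V) : emb (rnorm x) = `|x|.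
Proof. by rewrite emb_realpart_ge0. Qed.

Lemma rnorm_ge0 V (x : V) : 0 <= rnorm x.
Proof. by rewrite -(@ler_emb R k) emb_rnorm rmorph0. Qed.

Lemma rnorm0 V : rnorm (0 : V) = 0.
Proof. by rewrite /rnorm normr0 raddf0. Qed.

Lemma rnormN V (x : V) : rnorm (- x) = rnorm x.
Proof. by rewrite /rnorm normrN. Qed.

Lemma rnormD V (x y : V) : rnorm (x + y) <= rnorm x + rnorm y.
Proof. by rewrite -(@ler_emb R k) rmorphD/= !emb_rnorm ler_normD. Qed.

Lemma rnormB V (x y : V) : rnorm (x - y) <= rnorm x + rnorm y.
Proof. by rewrite (le_trans (rnormD _ _))// rnormN. Qed.

Lemma rnorm_distC V (x y : V) : rnorm (x - y) = rnorm (y - x).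
Proof. by rewrite -rnormN opprB. Qed.

Lemma rnorm_sum V n (F : nat -> V) :
  rnorm (\sum_(i < n) F i) <= \sum_(i < n) rnorm (F i).
Proof.
elim: n => [|n IH]; first by rewrite !big_ord0 rnorm0.
by rewrite !big_ord_recr/= (le_trans (rnormD _ _))// lerD2r.
Qed.

Lemma rnormZ V (a : K) (x : V) : rnorm (a *: x) = rnorm (a : K^o) * rnorm x.
Proof.
rewrite {1}/rnorm normrZ -[`|x|]emb_rnorm -[`|a|](@emb_rnorm K^o a).
by rewrite realpart_embM embK.
Qed.

Lemma rnorm_eq0 V (x : V) : (rnorm x == 0) = (x == 0).
Proof.
apply/eqP/eqP => [x0|->]; last exact: rnorm0.
by apply/eqP; rewrite -normr_eq0 -emb_rnorm x0 rmorph0.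
Qed.

Lemma rnorm_emb r : rnorm (emb r : K^o) = `|r|.
Proof. by rewrite /rnorm norm_emb embK. Qed.

Lemma rnorm1 : rnorm (1 : K^o) = 1.
Proof. by rewrite -(rmorph1 (@emb R k)) rnorm_emb normr1. Qed.

Lemma rnormM (a b : K) : rnorm (a * b : K^o) = rnorm (a : K^o) * rnorm (b : K^o).
Proof. exact: (@rnormZ K^o a b). Qed.

Lemma rnormZe V r (x : V) : rnorm (emb r *: x) = `|r| * rnorm x.
Proof. by rewrite rnormZ rnorm_emb. Qed.

Lemma realpart_le (a : K) : `|realpart a| <= rnorm (a : K^o).
Proof.
suff: `|realpart a| <= realpart (`|a| : K) by [].
rewrite /realpart; case: k a => //= -[a b] /=.
by rewrite -[leLHS]sqrtr_sqr ler_wsqrtr// lerDl sqr_ge0.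
Qed.

Lemma realpart_le_rnorm (a : K) : realpart a <= rnorm (a : K^o).
Proof. by rewrite (le_trans _ (realpart_le a))// ler_norm. Qed.

(** This transfers bounds on the real part of a functional to its modulus. *)
Lemma rotation (a : K) :
  exists2 w : K, rnorm (w : K^o) = 1 & realpart (w * a) = rnorm (a : K^o).
Proof.
have [->|a0] := eqVneq a 0.
  by exists 1; rewrite ?rnorm1// mulr0 raddf0 rnorm0.
exists (`|a| / a); last by rewrite divfK.
rewrite /rnorm normrM normr_id normfV divff ?normr_eq0//.
by rewrite -(rmorph1 (@emb R k)) embK.
Qed.

(** With [w = 1] for real scalars and the imaginary unit for complex ones, a
   statement about moduli reduces to two statements about real parts. *)
Lemma second_direction : exists2 w : K, rnorm (w : K^o) = 1 &
  forall a : K, rnorm (a : K^o) <= `|realpart a| + `|realpart (w * a)|.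
Proof.
suff: exists2 w : K, realpart (`|w| : K) = 1 &
  forall a : K, realpart (`|a| : K) <= `|realpart a| + `|realpart (w * a)| by [].
rewrite /realpart; case: k => /=.
  by exists 1 => [|a]; rewrite ?normr1// mul1r lerDl.
exists 'i%C => [|[a b]].
  by rewrite /= expr0n expr1n add0r sqrtr1.
rewrite /= !mul0r mul1r sub0r normrN.
rewrite -(ler_pXn2r (_ : (0 < 2)%N)) ?nnegrE ?sqrtr_ge0 ?addr_ge0//.
rewrite sqr_sqrtr ?addr_ge0 ?sqr_ge0// sqrrD !real_normK ?num_real//.
by rewrite addrAC lerDl mulrn_wge0// mulr_ge0.
Qed.

End RealNorm.

(** * The Hahn-Banach theorem *)

Section HahnBanach.
Context {R : realType} {k : scalar_kind}.
Local Notation K := (scalars R k).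
Variable V : lmodType K.
Implicit Types (q p g : V -> R).

(** Inequality in the homogeneity condition is equivalent to equality, by
   [sublinearZ], and easier to check for infima. *)
Definition sublinear q := (forall x y, q (x + y) <= q x + q y) /\
  (forall r x, 0 <= r -> q (emb r *: x) <= r * q x).

Definition real_linear g := (forall x y, g (x + y) = g x + g y) /\
  (forall r x, g (emb r *: x) = r * g x).

Lemma sublinear0 q : sublinear q -> q 0 = 0.
Proof.
move=> [qD qZ]; apply/eqP; rewrite eq_le; apply/andP; split.
  by have := qZ 0 0 (lexx 0); rewrite scaler0 mul0r.
by have := qD 0 0; rewrite addr0 lerDl.
Qed.

Lemma sublinearZ q r x : sublinear q -> 0 <= r -> q (emb r *: x) = r * q x.
Proof.
move=> sq; rewrite le_eqVlt => /predU1P[<-|r0].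
  by rewrite rmorph0 scale0r sublinear0// mul0r.
apply/eqP; rewrite eq_le (sq.2 _ _ (ltW r0))/= -ler_pdivlMl//.
have := sq.2 r^-1 (emb r *: x).
by rewrite invr_ge0 ltW// scalerA -rmorphM mulVf ?gt_eqF// rmorph1 scale1r; apply.
Qed.

Lemma sublinear_oppr q x : sublinear q -> - q (- x) <= q x.
Proof.
by move=> sq; have := sq.1 x (- x); rewrite subrr sublinear0//; lra.
Qed.

(** Every sublinear functional constructed here is such an infimum. The condition
   on sums says that the family [h] is jointly subadditive up to a change of the
   index, as is the case for chains and for inf-convolutions. *)
Lemma sublinear_inf (I : Type) (i0 : I) (h : I -> V -> R) (b : V -> R) :
  (forall i x, b x <= h i x) ->
  (forall i j x y, exists l, h l (x + y) <= h i x + h j y) ->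
  (forall i r x, 0 <= r -> exists l, h l (emb r *: x) <= r * h i x) ->
  sublinear (fun x => inf (range (h ^~ x))).
Proof.
move=> bh hD hZ.
have h0 x : range (h ^~ x) !=set0 by exists (h i0 x), i0.
have hb x : has_lbound (range (h ^~ x)) by exists (b x) => _ [i _ <-].
have infh i x : inf (range (h ^~ x)) <= h i x by apply: ge_inf => //; exists i.
split=> [x y|r x r0].
  rewrite -lerBlDr; apply: lb_le_inf => // _ [i _ <-].
  rewrite lerBlDr -lerBlDl; apply: lb_le_inf => // _ [j _ <-].
  rewrite lerBlDl; have [l] := hD i j x y.
  exact: (le_trans (infh _ _)).
have [->|rn0] := eqVneq r 0.
  have [l hl] := hZ i0 0 x (lexx _).
  by apply: (le_trans (infh l _)); apply: (le_trans hl); rewrite !mul0r.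
rewrite -ler_pdivrMl ?lt0r ?rn0//; apply: lb_le_inf => // _ [i _ <-].
rewrite ler_pdivrMl ?lt0r ?rn0//; have [l] := hZ i r x r0.
exact: (le_trans (infh _ _)).
Qed.

(** For fixed [y] the infimum over [t >= 0] of [p (x + t y) - t p y] is sublinear
   in [x] and below [p], hence equal to [p] by minimality; comparing with the
   term [t = 1] shows that [p] is superadditive. *)
Lemma minimal_sublinear_linear p : sublinear p ->
  (forall p', sublinear p' -> (forall x, p' x <= p x) -> p' = p) -> real_linear p.
Proof.
move=> sp pmin.
have pD x y : p (x + y) = p x + p y.
  apply/eqP; rewrite eq_le sp.1/=.
  pose I := {t : R | 0 <= t}; pose h (t : I) z := p (z + emb (sval t) *: y) - sval t * p y.
  have hb t z : - p (- z) <= h t z.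
    case: t => t t0; rewrite /h/= lerBrDr -(sublinearZ _ sp t0) addrC -lerBrDr opprK.
    by rewrite (le_trans _ (sp.1 _ _))// addrAC subrr add0r.
  have sh : sublinear (fun z => inf (range (h ^~ z))).
    apply: (sublinear_inf (exist _ 0 (lexx 0)) hb) => [[s s0] [t t0] u v|[s s0] r u r0].
      exists (exist _ (s + t) (addr_ge0 s0 t0)); rewrite /h/= rmorphD/= scalerDl.
      by have := sp.1 (u + emb s *: y) (v + emb t *: y); rewrite addrACA; lra.
    exists (exist _ (r * s) (mulr_ge0 r0 s0)); rewrite /h/= rmorphM/= -scalerA.
    by rewrite -scalerDr; have := sp.2 r (u + emb s *: y) r0; lra.
  have hlb z : has_lbound (range (h ^~ z)) by exists (- p (- z)) => _ [i _ <-].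
  have hp : (fun z => inf (range (h ^~ z))) = p.
    apply: pmin => // z; apply: ge_inf => //; exists (exist _ 0 (lexx 0)) => //.
    by rewrite /h/= rmorph0 scale0r mul0r subr0 addr0.
  rewrite -{1}hp -lerBrDr; apply: ge_inf => //; exists (exist _ 1 ler01) => //.
  by rewrite /h/= rmorph1 scale1r mul1r.
split=> [//|r x]; have pN z : p (- z) = - p z.
  by apply/eqP; rewrite -addr_eq0 -pD addNr sublinear0.
have [r0|r0] := leP 0 r; first exact: sublinearZ.
rewrite -[r]opprK rmorphN scaleNr pN (sublinearZ _ sp) ?oppr_ge0 ?ltW//.
by rewrite !mulNr.
Qed.

(** By Zorn's lemma there is a minimal sublinear functional below [q], since the
   infimum of a chain is sublinear, and a minimal one is linear. *)
Theorem hahn_banach q : sublinear q ->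
  exists2 g, real_linear g & forall x, g x <= q x.
Proof.
move=> sq; pose T := {p | sublinear p /\ forall x, p x <= q x}.
pose le_T (s t : T) := `[< forall x, sval t x <= sval s x >].
have [|s t u /asboolP st /asboolP tu|s t /asboolP st /asboolP ts|A chA|] := @Zorn T le_T.
- by move=> t; apply/asboolP.
- by apply/asboolP => x; exact: le_trans (tu x) (st x).
- case: s t st ts => s [? ?] [t [? ?]] /= st ts.
  apply: eq_exist => /=; apply/funext => x; apply/eqP.
  by rewrite eq_le ts st.
- have [[a Aa]|A0] := pselect (A !=set0); last first.
    exists (exist _ q (conj sq (fun x => lexx _))) => s As.
    by case: A0; exists s.
  pose I := {s : T | A s}; pose h (i : I) := sval (sval i).
  have hb (i : I) x : - q (- x) <= h i x.
    case: i => -[s [ss sq']] As; rewrite /h/=.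
    by rewrite (le_trans _ (sublinear_oppr _ ss))// lerN2.
  pose i0 : I := exist _ a Aa.
  have hlb z : has_lbound (range (h ^~ z)) by exists (- q (- z)) => _ [i _ <-].
  have sh : sublinear (fun z => inf (range (h ^~ z))).
    apply: (sublinear_inf i0 hb) => [i j x y|i r x r0].
      have [/asboolP ij|/asboolP ji] := chA _ _ (svalP i) (svalP j).
        exists j; have := ij x; rewrite -(lerD2r (h j y)).
        exact: (le_trans ((proj1 (svalP (sval j))).1 _ _)).
      exists i; have := ji y; rewrite -(lerD2l (h i x)).
      exact: (le_trans ((proj1 (svalP (sval i))).1 _ _)).
    by exists i; exact: (proj1 (svalP (sval i))).2.
  have hq x : inf (range (h ^~ x)) <= q x.
    apply: (@le_trans _ _ (h i0 x)); first by apply: ge_inf => //; exists i0.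
    exact: (proj2 (svalP a)).
  pose t : T := exist _ (fun z => inf (range (h ^~ z))) (conj sh hq).
  exists t => s As; apply/asboolP => x /=; apply: ge_inf => //.
  by exists (exist _ s As).
move=> [p [sp pq]] pmax; exists p => //.
apply: minimal_sublinear_linear => // p' sp' p'p.
have p'q x : p' x <= q x by exact: le_trans (p'p x) (pq x).
by have /(congr1 sval) := pmax (exist _ p' (conj sp' p'q)) (asboolT p'p).
Qed.

End HahnBanach.

(** * Functionals *)

Section DualBall.
Context {R : realType} {k : scalar_kind}.
Local Notation K := (scalars R k).
Variable X : normedModType K.

Definition bounded_by (C : R) (f : dual X) :=
  forall x, rnorm (dual_fun f x) <= C * rnorm x.

Lemma dualP (F : X -> K^o) (C : R) : linear F ->
  (forall x, rnorm (F x) <= C * rnorm x) -> exists f : dual X, dual_fun f = F.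
Proof.
move=> linF FC.
pose mF := GRing.isLinear.Build K X K^o *%R F linF.
pose lF : {linear X -> K^o} := HB.pack F mF.
suff cF : continuous lF by exists (exist _ lF cF).
apply: bounded_linear_continuous; apply/linear_boundedP.
exists (emb (`|C|)); split.
  by rewrite ger0_real// -(rmorph0 (@emb R k)) ler_emb.
move=> r /ltW Cr x; rewrite -!emb_rnorm (@le_trans _ _ (emb `|C| * emb (rnorm x)))//.
  rewrite -rmorphM ler_emb (le_trans (FC x))//.
  by rewrite ler_wpM2r ?rnorm_ge0// ler_norm.
by rewrite ler_wpM2r// emb_rnorm.
Qed.

Lemma dual_bounded (f : dual X) : exists2 C, 0 < C & bounded_by C f.
Proof.
have /linear_bounded_continuous/linear_boundedP := svalP f.
move=> /pinfty_ex_gt0[M M0 fM].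
exists (realpart M) => [|x].
  by rewrite -(@ltr_emb R k) (emb_realpart_ge0 (ltW M0)) rmorph0.
rewrite -(@ler_emb R k) rmorphM/= !emb_rnorm (emb_realpart_ge0 (ltW M0)).
exact: fM.
Qed.

Lemma dual_funD (f : dual X) x y :
  dual_fun f (x + y) = dual_fun f x + dual_fun f y.
Proof. by rewrite /dual_fun linearD. Qed.

Lemma dual_funB (f : dual X) x y :
  dual_fun f (x - y) = dual_fun f x - dual_fun f y.
Proof. by rewrite /dual_fun linearB. Qed.

Lemma dual_funZ (f : dual X) a x : dual_fun f (a *: x) = a * dual_fun f x.
Proof. by rewrite /dual_fun linearZ. Qed.

Lemma dual_fun0 (f : dual X) : dual_fun f 0 = 0.
Proof. by rewrite /dual_fun linear0. Qed.

Lemma dual_fun_sum (f : dual X) n (a : nat -> K) (x : nat -> X) :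
  dual_fun f (\sum_(i < n) a i *: x i) = \sum_(i < n) a i * dual_fun f (x i).
Proof. by rewrite /dual_fun linear_sum; under eq_bigr do rewrite linearZ. Qed.

Lemma dual_scale (f : dual X) C (c : K) : bounded_by C f ->
  exists2 g : dual X, (forall x, dual_fun g x = c * dual_fun f x) &
    bounded_by (rnorm (c : K^o) * C) g.
Proof.
move=> fC; have [||g gE] := @dualP (fun x => c * dual_fun f x) (rnorm (c : K^o) * C).
- by move=> a x y; rewrite dual_funD dual_funZ mulrDr mulrCA.
- by move=> x; rewrite rnormM -mulrA ler_wpM2l ?rnorm_ge0.
- by exists g => x; rewrite /bounded_by gE// rnormM -mulrA ler_wpM2l ?rnorm_ge0.
Qed.

End DualBall.

Section Complexification.
Context {R : realType}.

(** Over the complex numbers this is the classical formula giving a functional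
   from its real part, [F x = g x - i g (i x)]. *)
Lemma complexify k (X : normedModType (scalars R k)) (g : X -> R) :
  real_linear g ->
  exists2 F : X -> (scalars R k)^o, linear F & forall x, realpart (F x) = g x.
Proof.
case: k X g => X g [gD gZ].
  by exists g => // a x y; rewrite gD gZ.
exists (fun x => (g x +i* (- g ('i%C *: x)))%C) => // -[u v] x y.
have uvE : (u +i* v)%C = real_complex R u + real_complex R v * 'i%C :> R[i].
  by apply/eqP; rewrite eq_complex/= !mul0r !mulr0 !mulr1 subr0 !addr0 add0r !eqxx.
have E1 : g ((u +i* v)%C *: x) = u * g x + v * g ('i%C *: x).
  by rewrite {1}uvE scalerDl -scalerA gD !gZ.
have E2 : g ('i%C *: ((u +i* v)%C *: x)) = u * g ('i%C *: x) - v * g x.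
  rewrite scalerA uvE mulrDr mulrCA -expr2 sqr_i scalerDl gD mulrN1.
  by rewrite -mulrC -scalerA -rmorphN !gZ mulNr.
apply/eqP; rewrite eq_complex/= !gD scalerDr gD E1 E2.
by apply/andP; split; apply/eqP; rewrite /GRing.scale/=; ring.
Qed.

End Complexification.

(** * Separation of convex sets *)

Section Separation.
Context {R : realType} {k : scalar_kind}.
Local Notation K := (scalars R k).
Variable X : normedModType K.

Definition rconvex (D : set X) := forall x y s t, D x -> D y ->
  0 <= s -> 0 <= t -> s + t = 1 -> D (emb s *: x + emb t *: y).

(** The convex hull. Defining it as an intersection makes it possible to prove
   containments without handling finite convex combinations. *)
Definition rhull (A : set X) : set X :=
  [set x | forall D, rconvex D -> A `<=` D -> D x].

Lemma real_dual (g : X -> R) C : real_linear g ->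
  (forall x, g x <= C * rnorm x) ->
  exists2 f : dual X, bounded_by C f & forall x, realpart (dual_fun f x) = g x.
Proof.
move=> lg gC; have [F linF Fg] := complexify lg.
have FC x : rnorm (F x) <= C * rnorm x.
  have [w w1 wF] := rotation (F x); rewrite -wF.
  have -> : w * F x = F (w *: x).
    have F0 : F 0 = 0.
      by have := linF (-1) 0 0; rewrite scaler0 addr0 scaleN1r addNr.
    by rewrite -[w *: x]addr0 linF F0 addr0.
  by rewrite Fg (le_trans (gC _))// rnormZ w1 mul1r.
have [f fF] := dualP linF FC.
by exists f => x; rewrite fF.
Qed.

(** The sublinear functional is the infimum of [rnorm (v + t d) - t r] over
   [t >= 0] and [d] in [D]. It is below the norm, which bounds [f]; and its value at
   [- d] is at most [- r], which gives the lower bound on [D]. *)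
Theorem separation (D : set X) r : D !=set0 -> rconvex D ->
  (forall d, D d -> r <= rnorm d) ->
  exists2 f : dual X, bounded_by 1 f & forall d, D d -> r <= realpart (dual_fun f d).
Proof.
move=> [d0 Dd0] cD Dr.
pose I := ({t : R | 0 <= t} * {d | D d})%type.
pose h (i : I) (v : X) := rnorm (v + emb (sval i.1) *: sval i.2) - sval i.1 * r.
pose i0 : I := (exist _ 0 (lexx 0), exist _ d0 Dd0).
have hb i v : - rnorm v <= h i v.
  case: i => -[t t0] [d Dd]; rewrite /h/=.
  have := rnormB (v + emb t *: d) v; rewrite addrAC subrr add0r rnormZe ger0_norm//.
  by have := ler_wpM2l t0 (Dr _ Dd); lra.
have hlb v : has_lbound (range (h ^~ v)) by exists (- rnorm v) => _ [i _ <-].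
have sh : sublinear (fun v => inf (range (h ^~ v))).
  apply: (sublinear_inf i0 hb) => [[[s s0] [d Dd]] [[t t0] [e De]] u v|].
    have [st0|st0] := eqVneq (s + t) 0.
      have s00 : s = 0 by lra.
      have t00 : t = 0 by lra.
      exists i0; rewrite /h/= s00 t00 !rmorph0 !scale0r !addr0 !mul0r !subr0.
      exact: rnormD.
    have De' : D (emb (s / (s + t)) *: d + emb (t / (s + t)) *: e).
      apply: cD => //; rewrite ?divr_ge0 ?addr_ge0//.
      by rewrite -mulrDl divff.
    exists (exist _ (s + t) (addr_ge0 s0 t0), exist _ _ De'); rewrite /h/=.
    rewrite scalerDr !scalerA -!rmorphM/= ![(s + t) * _]mulrC !divfK// addrACA.
    by have := rnormD (u + emb s *: d) (v + emb t *: e); lra.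
  move=> [[s s0] [d Dd]] r' u r0.
  exists (exist _ (r' * s) (mulr_ge0 r0 s0), exist _ d Dd); rewrite /h/=.
  by rewrite rmorphM -scalerA -scalerDr rnormZe ger0_norm//; lra.
have [g lg gh] := hahn_banach sh.
have [x|f f1 fg] := real_dual (C := 1) lg.
  rewrite mul1r (le_trans (gh x))// ge_inf//; exists i0 => //.
  by rewrite /h/= rmorph0 scale0r mul0r subr0 addr0.
exists f => // d Dd; rewrite fg -lerN2.
have -> : - g d = g (- d) by have := lg.2 (-1) d; rewrite rmorphN1 scaleN1r mulN1r.
rewrite (le_trans (gh _))// ge_inf//; exists (exist _ 1 ler01, exist _ d Dd) => //.
by rewrite /h/= rmorph1 scale1r addNr rnorm0 mul1r sub0r.
Qed.

Corollary norming u :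
  exists2 f : dual X, bounded_by 1 f & rnorm u <= realpart (dual_fun f u).
Proof.
have cu : rconvex [set u].
  by move=> _ _ s t -> -> _ _ st; rewrite /= -scalerDl -rmorphD st rmorph1 scale1r.
have [|d ->//|f f1 fu] := separation (r := rnorm u) _ cu; first by exists u.
by exists f => //; exact: fu.
Qed.

Lemma rhull_convex A : rconvex (rhull A).
Proof.
move=> x y s t Ax Ay s0 t0 st D cD AD.
by apply: (cD) => //; [exact: (Ax _ cD AD)|exact: (Ay _ cD AD)].
Qed.

Lemma sub_rhull A : A `<=` rhull A.
Proof. by move=> x Ax D _; apply. Qed.

Lemma rhull_sub A D : rconvex D -> A `<=` D -> rhull A `<=` D.
Proof. by move=> cD AD x; apply. Qed.

(** Convexity in terms of scalars in [0, 1] only concerns real scalars, as the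
   order of the complex numbers compares elements with equal imaginary parts. *)
Lemma convex_set_rconvex (C : set X) : @convex_set K X C -> rconvex C.
Proof.
move=> cC x y s t Cx Cy s0 t0 st.
have es0 : 0 <= emb s :> K by rewrite -(rmorph0 (@emb R k)) ler_emb.
have es1 : emb s <= 1 :> K by rewrite -(rmorph1 (@emb R k)) ler_emb -st lerDl.
have := cC x y (Itv01 es0 es1); rewrite !inE => /(_ Cx Cy).
rewrite /conv/= /unstable.onem.
by rewrite -(rmorph1 (@emb R k)) -rmorphB -st addrAC subrr add0r.
Qed.

Lemma rconvex_ball u r : rconvex [set x | rnorm (x - u) <= r].
Proof.
move=> x y s t /= xr yr s0 t0 st.
have -> : emb s *: x + emb t *: y - u = emb s *: (x - u) + emb t *: (y - u).
  rewrite !scalerBr addrACA -opprD -scalerDl -rmorphD/= st rmorph1.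
  by rewrite scale1r.
rewrite (le_trans (rnormD _ _))// !rnormZe !ger0_norm//.
by have := ler_wpM2l s0 xr; have := ler_wpM2l t0 yr; nra.
Qed.

Lemma realpart_dual_comb (f : dual X) x y s t :
  realpart (dual_fun f (emb s *: x + emb t *: y)) =
  s * realpart (dual_fun f x) + t * realpart (dual_fun f y).
Proof. by rewrite dual_funD !dual_funZ raddfD/= !realpart_embM. Qed.

Lemma rconvex_halfspace_gt (f : dual X) r :
  rconvex [set x | r < realpart (dual_fun f x)].
Proof.
move=> x y s t /= xr yr; rewrite realpart_dual_comb.
rewrite le_eqVlt => /predU1P[<-|s0] t0 st.
  by move: st; rewrite add0r => ->; rewrite mul0r mul1r add0r.
have : s * r < s * realpart (dual_fun f x) by rewrite ltr_pM2l.
by have := ler_wpM2l t0 (ltW yr); nra.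
Qed.

End Separation.

(** * Total boundedness in finite dimension *)

Section Nets.
Context {R : realType} {k : scalar_kind}.
Local Notation K := (scalars R k).

Lemma real_net (B r : R) : 0 < r ->
  exists s : seq R, forall a, `|a| <= B -> exists2 b, b \in s & `|a - b| <= r.
Proof.
move=> r0; pose N := (Num.truncn (2 * B / r)).+1.
exists [seq i%:R * r - B | i <- iota 0 N] => a; rewrite ler_norml => /andP[Ba aB].
have q0 : 0 <= (a + B) / r by rewrite divr_ge0 ?(ltW r0)//; lra.
have /andP[q1 q2] := truncn_itv q0.
exists ((Num.truncn ((a + B) / r))%:R * r - B).
  apply/mapP; exists (Num.truncn ((a + B) / r)) => //.
  rewrite mem_iota/= add0n ltnS; apply: le_truncn.
  by rewrite ler_pM2r ?invr_gt0//; lra.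
move: q1 q2; rewrite ler_pdivlMr// ltr_pdivrMr// -natr1 => q1 q2.
by rewrite ler_norml; apply/andP; split; nra.
Qed.

Lemma scalar_net (B r : R) : 0 < r -> exists s : seq K, forall a : K,
  rnorm (a : K^o) <= B -> exists2 b, b \in s & rnorm (a - b : K^o) <= r.
Proof.
suff: 0 < r -> exists s : seq K, forall a : K,
  realpart (`|a| : K) <= B -> exists2 b, b \in s & realpart (`|a - b| : K) <= r by [].
rewrite /realpart; case: k => r0; first exact: real_net.
have [s sB] := real_net B (divr_gt0 r0 (ltr0n R 2)).
exists [seq (a +i* b)%C | a <- s, b <- s] => -[a b] abB.
have ab x y : `|x| <= complex.Re `|(x +i* y)%C : R[i]|.
  by rewrite /= -[leLHS]sqrtr_sqr ler_wsqrtr// lerDl sqr_ge0.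
have ab' x y : `|y| <= complex.Re `|(x +i* y)%C : R[i]|.
  by rewrite /= -[leLHS]sqrtr_sqr ler_wsqrtr// lerDr sqr_ge0.
have [a' a's aa'] := sB a (le_trans (ab _ _) abB).
have [b' b's bb'] := sB b (le_trans (ab' _ _) abB).
exists (a' +i* b')%C; first by apply/allpairsP; exists (a', b').
rewrite /= -(ler_pXn2r (_ : (0 < 2)%N)) ?nnegrE ?sqrtr_ge0 ?(ltW r0)//.
rewrite sqr_sqrtr ?addr_ge0 ?sqr_ge0//.
rewrite -(real_normK (num_real (a - a'))) -(real_normK (num_real (b - b'))).
have := normr_ge0 (a - a'); have := normr_ge0 (b - b'); nra.
Qed.

Variable X : normedModType K.

(** Adding one direction at a time suits the induction of [span_net]. *)
Fixpoint span_seq (s : seq X) : set X :=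
  if s is v :: s' then [set w | exists c : K, span_seq s' (w - c *: v)]
  else [set 0].

Lemma span_seq_lin s a x y : span_seq s x -> span_seq s y ->
  span_seq s (a *: x + y).
Proof.
elim: s x y => [|v s IH] x y /=; first by move=> -> ->; rewrite scaler0 addr0.
move=> [c xc] [d yd]; exists (a * c + d).
have -> : a *: x + y - (a * c + d) *: v = a *: (x - c *: v) + (y - d *: v).
  by rewrite scalerBr scalerDl scalerA opprD addrACA.
exact: IH.
Qed.

Lemma span_seq0 s : span_seq s 0.
Proof. by elim: s => [|v s IH] //=; exists 0; rewrite scale0r subr0. Qed.

Lemma span_seqZ s a x : span_seq s x -> span_seq s (a *: x).
Proof. by move=> sx; rewrite -[_ *: _]addr0; apply: span_seq_lin => //; exact: span_seq0. Qed.

Lemma mem_span_seq s v : v \in s -> span_seq s v.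
Proof.
elim: s => // u s IH; rewrite inE => /predU1P[->|/IH vs] /=.
  by exists 1; rewrite scale1r subrr; exact: span_seq0.
by exists 0; rewrite scale0r subr0.
Qed.

(** Bounded parts of finite-dimensional subspaces are totally bounded. In the
   inductive step the new direction is either at positive distance from the
   previous span, and then coordinates are controlled by the norm, or it lies in
   its closure, and then it contributes nothing up to a small error. *)
Lemma span_net s (B r : R) : 0 < r -> exists N : seq X, forall w,
  span_seq s w -> rnorm w <= B -> exists2 u, u \in N & rnorm (w - u) <= r.
Proof.
elim: s B r => [|v s IH] B r r0 /=.
  by exists [:: 0] => w -> _; exists 0; rewrite ?mem_seq1// subrr rnorm0 ltW.
have [[rho [rho0 far]]|near] := pselect (exists rho, 0 < rho /\
  forall c u, span_seq s u -> rho * rnorm (c : K^o) <= rnorm (c *: v + u)).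
- have nv : 0 < 2 * (rnorm v + 1) by have := rnorm_ge0 v; lra.
  have [S Snet] := scalar_net (B / rho) (divr_gt0 r0 nv).
  have [N Nnet] := IH (B + B / rho * rnorm v) _ (divr_gt0 r0 (ltr0n R 2)).
  exists [seq c *: v + u | c <- S, u <- N] => w [c wc] wB.
  have cB : rnorm (c : K^o) <= B / rho.
    by rewrite ler_pdivlMr// mulrC (le_trans (far c _ wc))// addrC subrK.
  have [c' c'S cc'] := Snet _ cB.
  have [|u uN wu] := Nnet _ wc.
    by rewrite (le_trans (rnormB _ _))// lerD// rnormZ ler_wpM2r ?rnorm_ge0.
  exists (c' *: v + u); first by apply/allpairsP; exists (c', u).
  have -> : w - (c' *: v + u) = (w - c *: v - u) + (c - c') *: v.
    by rewrite scalerBl addrA [X in _ = X - _]addrAC subrK opprD addrA addrAC.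
  rewrite (le_trans (rnormD _ _))// rnormZ.
  have h1 : r / (2 * (rnorm v + 1)) * rnorm v <= r / 2.
    rewrite invfM mulrA -mulrA ler_piMr ?divr_ge0 ?(ltW r0)//.
    by rewrite mulrC ler_pdivrMr; have := rnorm_ge0 v; lra.
  by have := ler_wpM2r (rnorm_ge0 v) cc'; lra.
- have [N Nnet] := IH (B + 1) _ (divr_gt0 r0 (ltr0n R 2)).
  exists N => w [c wc] wB.
  (* [v] is replaced by [v'] in the span of [s], with an error at most [e] on [w]. *)
  pose e := Num.min 1 (r / 2); have e0 : 0 < e by rewrite lt_min ltr01 divr_gt0.
  have e1 : e <= 1 by rewrite ge_min lexx.
  have er : e <= r / 2 by rewrite ge_min lexx orbT.
  have c1 : 0 < rnorm (c : K^o) + 1 by have := rnorm_ge0 (c : K^o); lra.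
  have [v' sv' vv'] : exists2 v', span_seq s v' &
      rnorm (v - v') <= e / (rnorm (c : K^o) + 1).
    apply: contrapT => nv; apply: near.
    exists (e / (rnorm (c : K^o) + 1)); split; first exact: divr_gt0.
    move=> d u su; have [->|d0] := eqVneq d 0; first by rewrite rnorm0 mulr0 rnorm_ge0.
    have -> : d *: v + u = d *: (v - (- d^-1) *: u).
      by rewrite scalerBr scalerA mulrN divff// scaleN1r opprK.
    rewrite rnormZ mulrC ler_wpM2l ?rnorm_ge0// leNgt; apply/negP => lt.
    by apply: nv; exists ((- d^-1) *: u); [exact: span_seqZ|exact: ltW].
  have ww' : rnorm (w - (c *: v' + (w - c *: v))) <= e.
    have -> : w - (c *: v' + (w - c *: v)) = c *: (v - v').
      by rewrite opprD opprB addrCA (addrC w) subrK addrC scalerBr.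
    rewrite rnormZ (le_trans (ler_wpM2l (rnorm_ge0 _) vv'))//.
    rewrite mulrCA ler_piMr ?(ltW e0)//.
    by rewrite ler_pdivrMr//; lra.
  have sw' : span_seq s (c *: v' + (w - c *: v)) by exact: span_seq_lin.
  have [|u uN wu] := Nnet _ sw'.
    have := rnormB w (w - (c *: v' + (w - c *: v))); rewrite subKr; lra.
  exists u => //.
  have := rnormD (w - (c *: v' + (w - c *: v))) (c *: v' + (w - c *: v) - u).
  by rewrite addrA subrK; lra.
Qed.

End Nets.

(** * Weak convergence *)

(** Dependent choice, each term depending on all the preceding ones. *)
Lemma choice_history (T : Type) (P : seq T -> T -> Prop) :
  (forall h, exists t, P h t) -> exists s : nat -> T, forall n, P (mkseq s n) (s n).
Proof.
move=> /choice[F PF].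
pose hist n := iter n (fun h => rcons h (F h)) [::].
exists (fun n => F (hist n)) => n.
suff -> : mkseq (fun n => F (hist n)) n = hist n by exact: PF.
by elim: n => // n IH; rewrite mkseqS IH.
Qed.

Section WeakTopology.
Context {R : realType} {k : scalar_kind}.
Local Notation K := (scalars R k).
Variable X : normedModType K.

Lemma weak_cvgP (F : set_system X) (l : X) : Filter F ->
  (forall (f : dual X) e, 0 < e -> F [set x | rnorm (dual_fun f x - dual_fun f l) < e]) ->
  (F : set_system (weak X)) --> (l : weak X).
Proof.
move=> FF Fl; apply/cvg_sup => f A /=.
move=> [_ [[B oB <-] /= Bl BA]].
have /nbhs_ballP[e /= e0 eB] : nbhs (dual_fun f l) B by exact: open_nbhs_nbhs.
have re0 : 0 < realpart e.
  by rewrite -(@ltr_emb R k) (emb_realpart_ge0 (ltW e0)) rmorph0.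
apply: filterS (Fl f _ re0) => x /= xl; apply: BA; apply: (eB (dual_fun f x)).
rewrite -ball_normE/= -emb_rnorm -(emb_realpart_ge0 (ltW e0)) ltr_emb.
by rewrite rnorm_distC.
Qed.

Lemma cvg_weak (F : set_system X) (l : X) (f : dual X) e : Filter F ->
  (F : set_system (weak X)) --> (l : weak X) -> 0 < e ->
  F [set x | rnorm (dual_fun f x - dual_fun f l) < e].
Proof.
move=> FF /cvg_sup => /(_ f) Fl e0.
have ee0 : 0 < emb e :> K by rewrite -(rmorph0 (@emb R k)) ltr_emb.
have FB : F (dual_fun f @^-1` ball (dual_fun f l) (emb e)).
  apply: Fl; apply: (@initial_continuous X K^o (dual_fun f) l).
  exact: nbhsx_ballx.
apply: filterS FB => x; rewrite /preimage/= -ball_normE/= -emb_rnorm ltr_emb.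
by rewrite rnorm_distC.
Qed.

(** The real parts of [f] and of [w * f] control the moduli of the values of [f]. *)
Lemma weak_cvg_realpart (F : set_system X) (l : X) : Filter F ->
  (forall (f : dual X) e, 0 < e -> F [set x | `|realpart (dual_fun f (x - l))| <= e]) ->
  (F : set_system (weak X)) --> (l : weak X).
Proof.
move=> FF Fl; apply: weak_cvgP => f e e0.
have [w w1 wP] := @second_direction R k; have [C _ fC] := dual_bounded f.
have [g gE _] := dual_scale w fC.
have e30 : 0 < e / 3 by lra.
apply: filterS2 (Fl f _ e30) (Fl g _ e30) => x /=.
rewrite gE -dual_funB => fx gx.
by have := wP (dual_fun f (x - l)); lra.
Qed.

Lemma unimodular_scale (f : dual X) C (w : K) : bounded_by C f -> rnorm (w : K^o) = 1 ->
  exists2 g : dual X, (forall x, dual_fun g x = w * dual_fun f x) & bounded_by C g.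
Proof.
move=> fC w1; have [g gE gC] := dual_scale w fC.
by exists g; rewrite // -[C]mul1r -w1.
Qed.

Lemma closed_far (C : set X) u : closed C -> ~ C u ->
  exists2 r, 0 < r & forall c, C c -> r <= rnorm (c - u).
Proof.
move=> cC Cu; have : nbhs u (~` C).
  by apply: open_nbhs_nbhs; split => //; exact: closed_openC.
move=> /nbhs_ballP[e /= e0 eC].
exists (realpart e).
  by rewrite -(@ltr_emb R k) (emb_realpart_ge0 (ltW e0)) rmorph0.
move=> c Cc; rewrite leNgt; apply/negP => cu.
apply: (eC c) => //; rewrite -ball_normE/= -emb_rnorm -(emb_realpart_ge0 (ltW e0)).
by rewrite ltr_emb rnorm_distC.
Qed.

Lemma bounded_rnorm (C : set X) : bounded_set C ->
  exists2 B, 0 < B & forall c, C c -> rnorm c <= B.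
Proof.
move=> /pinfty_ex_gt0[M M0 CM]; exists (realpart M).
  by rewrite -(@ltr_emb R k) (emb_realpart_ge0 (ltW M0)) rmorph0.
move=> c Cc; rewrite -(@ler_emb R k) emb_rnorm (emb_realpart_ge0 (ltW M0)).
exact: CM.
Qed.

Lemma dual_cauchy (x : nat -> X) :
  (forall (f : dual X), bounded_by 1 f -> forall e, 0 < e ->
    exists N, forall m n, (N <= m)%N -> (N <= n)%N ->
      rnorm (dual_fun f (x m) - dual_fun f (x n)) < e) ->
  weakly_cauchy x.
Proof.
move=> xf f; apply/cauchy_ballP => e e0.
have re0 : 0 < realpart e.
  by rewrite -(@ltr_emb R k) (emb_realpart_ge0 (ltW e0)) rmorph0.
have [C C0 fC] := dual_bounded f.
have Cn : rnorm (emb C^-1 : K^o) = C^-1 by rewrite rnorm_emb gtr0_norm ?invr_gt0.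
have [g gE g1] := dual_scale (emb C^-1) fC.
rewrite Cn mulVf ?gt_eqF// in g1.
have e10 : 0 < C^-1 * realpart e by rewrite mulr_gt0 ?invr_gt0.
have [N NP] := xf g g1 _ e10.
pose T := [set dual_fun f (x n) | n in [set n | (N <= n)%N]].
exists (T, T) => /=; first by split; exists N => // n Nn; exists n.
move=> [_ _] /= [[m Nm <-] [n Nn <-]].
rewrite -ball_normE/= -(@emb_rnorm R k K^o) -(emb_realpart_ge0 (ltW e0)) ltr_emb.
have := NP _ _ Nm Nn; rewrite !gE -mulrBr rnormM Cn ltr_pM2l ?invr_gt0//.
Qed.

End WeakTopology.

Section Complete.
Context {R : realType} {k : scalar_kind}.
Local Notation K := (scalars R k).

Lemma rnorm_complete (X : completeNormedModType K) (u : nat -> X) :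
  (forall e, 0 < e -> exists N, forall m n, (N <= m)%N -> (N <= n)%N ->
     rnorm (u m - u n) <= e) ->
  exists l, forall e, 0 < e -> exists N, forall n, (N <= n)%N -> rnorm (u n - l) <= e.
Proof.
move=> uC; have : cvg (u @ \oo).
  apply/cauchy_cvgP/cauchy_ballP => e e0.
  have re0 : 0 < realpart e.
    by rewrite -(@ltr_emb R k) (emb_realpart_ge0 (ltW e0)) rmorph0.
  have [N NP] := uC (realpart e / 2) (divr_gt0 re0 (ltr0n _ 2)).
  pose T := [set u n | n in [set n | (N <= n)%N]].
  exists (T, T) => /=; first by split; exists N => // n Nn; exists n.
  move=> [_ _] /= [[m Nm <-] [n Nn <-]].
  rewrite -ball_normE/= -emb_rnorm -(emb_realpart_ge0 (ltW e0)) ltr_emb.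
  by have := NP _ _ Nm Nn; lra.
move=> /cvg_ex[l ul]; exists l => e e0.
have ee0 : 0 < emb e :> K by rewrite -(rmorph0 (@emb R k)) ltr_emb.
have /cvgrPdist_le/(_ _ ee0)[N _ NP] := ul.
exists N => n Nn; rewrite -(@ler_emb R k) emb_rnorm distrC.
exact: NP.
Qed.

End Complete.

(** * Limits of bounded functions along ultrafilters *)

Section UltraLimit.
Context {R : realType}.

Lemma real_ultra_limit (T : Type) (U : set_system T) (C : set T) (h : T -> R) B :
  UltraFilter U -> U C -> (forall x, C x -> `|h x| <= B) ->
  exists c, forall e, 0 < e -> U [set x | `|h x - c| <= e].
Proof.
move=> UU UC hB; pose S := [set t | U [set x | t <= h x]].
have SB : S (- B) by apply: filterS UC => x /hB; rewrite ler_norml => /andP[].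
have Sub : ubound S B.
  move=> t St; have [x [/= tx /hB]] := filter_ex (filterI St UC).
  by rewrite ler_norml => /andP[_]; exact: le_trans.
have hS : has_sup S by split; [exists (- B)|exists B].
exists (sup S) => e e0.
have [t St tS] := sup_adherent e0 hS.
have Ue : U (~` [set x | sup S + e <= h x]).
  have [|//] := in_ultra_setVsetC [set x | sup S + e <= h x] UU.
  by move=> /(ub_le_sup hS.2); lra.
apply: filterS2 St Ue => x /= tx /negP; rewrite -ltNge => xe.
by rewrite ler_norml; apply/andP; split; lra.
Qed.

Lemma ultra_limit k (T : Type) (U : set_system T) (C : set T)
    (h : T -> (scalars R k)^o) B :
  UltraFilter U -> U C -> (forall x, C x -> rnorm (h x) <= B) ->
  exists c, forall e, 0 < e -> U [set x | rnorm (h x - c) <= e].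
Proof.
suff: UltraFilter U -> U C -> (forall x, C x -> realpart `|h x : scalars R k| <= B) ->
  exists c, forall e, 0 < e -> U [set x | realpart `|h x - c : scalars R k| <= e] by [].
rewrite /realpart; case: k h => h UU UC hB.
  exact: real_ultra_limit UC hB.
have [|a aP] := real_ultra_limit (h := fun x => complex.Re (h x)) (B := B) UU UC.
  move=> x /hB; apply: le_trans; case: (h x) => a b /=.
  by rewrite -[leLHS]sqrtr_sqr ler_wsqrtr// lerDl sqr_ge0.
have [|b bP] := real_ultra_limit (h := fun x => complex.Im (h x)) (B := B) UU UC.
  move=> x /hB; apply: le_trans; case: (h x) => u v /=.
  by rewrite -[leLHS]sqrtr_sqr ler_wsqrtr// lerDr sqr_ge0.
exists (a +i* b)%C => e e0; have e2 : 0 < e / 2 by lra.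
apply: filterS2 (aP _ e2) (bP _ e2) => x /=; case: (h x) => u v /= au bv.
rewrite -(ler_pXn2r (_ : (0 < 2)%N)) ?nnegrE ?sqrtr_ge0 ?(ltW e0)//.
rewrite sqr_sqrtr ?addr_ge0 ?sqr_ge0//.
rewrite -(real_normK (num_real (u - a))) -(real_normK (num_real (v - b))).
have := normr_ge0 (u - a); have := normr_ge0 (v - b); nra.
Qed.

End UltraLimit.

(** * Sequences witnessing the lack of weak compactness *)

Section James.
Context {R : realType} {k : scalar_kind}.
Local Notation K := (scalars R k).
Variable X : completeNormedModType K.

(** If the hulls of the members of [U] came arbitrarily close to
   finite-dimensional subspaces, then, bounded parts of these being totally
   bounded and [U] being an ultrafilter, for each [d] there would be a single vector
   at distance at most [d] from all these hulls. These vectors would form a Cauchy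
   sequence, whose limit would be the weak limit of [U] and, by separation, would
   lie in [C]. *)
Lemma ultra_hull_gap (C : set X) (U : set_system X) :
  bounded_closed_convex C -> UltraFilter U -> U C ->
  (forall p, C p -> ~ (U : set_system (weak X)) --> (p : weak X)) ->
  exists2 d, 0 < d & forall s : seq X, exists2 A, U A &
    forall a u, rhull A a -> span_seq s u -> d <= rnorm (a - u).
Proof.
move=> [_ /bounded_rnorm[B B0 CB] clC /convex_set_rconvex cC] UU UC Ucvg.
apply: contrapT => nogap.
have close d : 0 < d -> exists u, forall A, U A ->
    exists2 a, rhull A a & rnorm (a - u) <= d.
  move=> d0; have d20 : 0 < d / 2 by lra.
  have [s sP] : exists s, forall A, U A -> exists2 a, rhull A a &
      exists2 u, span_seq s u & rnorm (a - u) < d / 2.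
    apply: contrapT => ns; apply: nogap; exists (d / 2) => // s.
    apply: contrapT => nA; apply: ns; exists s => A UA.
    apply: contrapT => na; apply: nA; exists A => // a u Aa su.
    by rewrite leNgt; apply/negP => au; apply: na; exists a => //; exists u.
  (* If each of the finitely many points of a net failed for some member of [U],
     then the intersection of these members would be far from the whole net. *)
  have [N Nnet] := span_net s (B + d / 2) d20.
  apply: contrapT => nu.
  have far u : exists2 A, U A & forall a, rhull A a -> d < rnorm (a - u).
    apply: contrapT => nA; apply: nu; exists u => A UA.
    apply: contrapT => na; apply: nA; exists A => // a Aa.
    by rewrite ltNge; apply/negP => au; apply: na; exists a.
  have [A UA AN] : exists2 A, U A & forall a u, u \in N -> rhull A a ->
      d < rnorm (a - u).
    elim: (N) => [|v N' [A UA AN']]; first by exists setT => //; exact: filterT.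
    have [A' UA' Av] := far v; exists (A `&` A') => [|a u]; first exact: filterI.
    rewrite inE => /predU1P[->|uN'] Aa; [apply: Av|apply: AN' => //].
      by apply: rhull_sub Aa; [exact: rhull_convex|move=> x [_ ?]; exact: sub_rhull].
    by apply: rhull_sub Aa; [exact: rhull_convex|move=> x [? _]; exact: sub_rhull].
  have [a Aa [u su au]] := sP _ (filterI UA UC).
  have aB : rnorm a <= B.
    suff : [set x | rnorm (x - 0) <= B] a by rewrite /= subr0.
    apply: rhull_sub Aa; first exact: rconvex_ball.
    by move=> x [_ /CB]; rewrite /= subr0.
  have [|v vN uv] := Nnet _ su.
    by have := rnormB a (a - u); rewrite subKr; lra.
  have := AN a v vN; have : rhull A a.
    by apply: rhull_sub Aa; [exact: rhull_convex|move=> x [? _]; exact: sub_rhull].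
  move=> Aa' /(_ Aa'); have := rnormD (a - u) (u - v).
  by rewrite addrA subrK; lra.
(* Otherwise an open half-space missing the ball of radius [d] around [u] would
   belong to [U], and so would contain the hull of a member. *)
have near d u : (forall A, U A -> exists2 a, rhull A a & rnorm (a - u) <= d) ->
    forall f : dual X, bounded_by 1 f ->
    U [set x | `|realpart (dual_fun f (x - u))| <= d].
  move=> uP.
  have half (f : dual X) : bounded_by 1 f ->
      U [set x | realpart (dual_fun f x) <= realpart (dual_fun f u) + d].
    move=> f1; pose A := [set x | realpart (dual_fun f u) + d < realpart (dual_fun f x)].
    have [/uP[a Aa au]|] := in_ultra_setVsetC A UU; last first.
      by apply: filterS => x /= /negP; rewrite -leNgt.
    have : A a by apply: rhull_sub Aa => //; exact: rconvex_halfspace_gt.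
    rewrite /A/=; have := realpart_le_rnorm (dual_fun f (a - u)).
    by have := f1 (a - u); rewrite mul1r dual_funB raddfB/=; lra.
  move=> f f1.
  have m1 : rnorm (-1 : K^o) = 1 by rewrite rnormN rnorm1.
  have [g gE g1] := unimodular_scale f1 m1.
  apply: filterS2 (half f f1) (half g g1) => x /=.
  rewrite !gE !mulN1r !raddfN/= dual_funB raddfB/= ler_norml => h1 h2.
  by apply/andP; split; lra.
have epos n : 0 < n.+1%:R^-1 :> R by rewrite invr_gt0 ltr0n.
have [u uP] : exists u : nat -> X, forall n A, U A ->
    exists2 a, rhull A a & rnorm (a - u n) <= n.+1%:R^-1.
  by have /choice[u uP] := fun n => close _ (epos n); exists u.
have [l lP] : exists l, forall e, 0 < e ->
    exists N, forall n, (N <= n)%N -> rnorm (u n - l) <= e.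
  apply: rnorm_complete => e e0; exists (Num.truncn (2 / e)).
  have small n : (Num.truncn (2 / e) <= n)%N -> n.+1%:R^-1 <= e / 2.
    move=> Nn; rewrite -[e / 2]invrK ler_pV2 ?inE ?unitfE ?gt_eqF ?invr_gt0 ?divr_gt0 ?ltr0n//.
    rewrite invf_div (le_trans (ltW (truncnS_gt _)))// ler_nat ltnS//.
  move=> m n /small mN /small nN; have [f f1 fn] := norming (u m - u n).
  have [x [/= xm xn]] := filter_ex (filterI (near _ _ (uP m) f f1) (near _ _ (uP n) f f1)).
  apply: (le_trans fn); move: xm xn; rewrite !dual_funB !raddfB/= !ler_norml.
  move: (m.+1%:R^-1) (n.+1%:R^-1) mN nN => a b ma nb.
  by move=> /andP[? ?] /andP[? ?]; lra.
have Ul : (U : set_system (weak X)) --> (l : weak X).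
  apply: weak_cvg_realpart => f e e0; have [M M0 fM] := dual_bounded f.
  have Mn : rnorm (emb M^-1 : K^o) = M^-1 by rewrite rnorm_emb gtr0_norm ?invr_gt0.
  have [g gE] := dual_scale (emb M^-1) fM; rewrite Mn mulVf ?gt_eqF// => g1.
  have e2 : 0 < e / M / 2 by rewrite !divr_gt0.
  have [N1 N1P] := lP _ e2; pose n := maxn N1 (Num.truncn (e / M / 2)^-1).
  have nn : n.+1%:R^-1 <= e / M / 2.
    rewrite -[leRHS]invrK ler_pV2 ?inE ?unitfE ?gt_eqF ?invr_gt0 ?ltr0n//.
    rewrite (le_trans (ltW (truncnS_gt _)))// ler_nat ltnS//.
    by rewrite leq_max leqnn orbT.
  apply: filterS (near _ _ (uP n) g g1) => x /=.
  move: (n.+1%:R^-1) nn => a nn; have := N1P n (leq_maxl _ _).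
  have := realpart_le (dual_fun g (u n - l)).
  have := g1 (u n - l); rewrite mul1r => h1 h2 h3 h4.
  have : `|realpart (dual_fun g (x - l))| <= e / M.
    have -> : x - l = (x - u n) + (u n - l) by rewrite addrA subrK.
    rewrite dual_funD raddfD/= (le_trans (ler_normD _ _))//.
    by have := realpart_le (dual_fun g (u n - l)); lra.
  rewrite gE realpart_embM normrM gtr0_norm ?invr_gt0// mulrC ler_pM2r ?invr_gt0//.
(* It remains to prove that the weak limit [l] belongs to [C]. *)
apply: (Ucvg l _ Ul); apply: contrapT => Cl.
have [r r0 rP] := closed_far clC Cl.
pose D := [set d | exists2 c, C c & d = c - l].
have [x Cx] := filter_ex UC.
have [|||f f1 fD] := @separation _ _ X D r; first by exists (x - l), x.
- move=> _ _ s t [c Cc ->] [c' Cc' ->] s0 t0 st.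
  exists (emb s *: c + emb t *: c'); first exact: cC.
  by rewrite !scalerBr addrACA -opprD -scalerDl -rmorphD st rmorph1 scale1r.
- by move=> _ [c Cc ->]; exact: rP.
have [y [Cy]] := filter_ex (filterI UC (cvg_weak f _ Ul r0)).
rewrite /= -dual_funB; have := fD (y - l); have := realpart_le_rnorm (dual_fun f (y - l)).
by move=> h1 /(_ (ex_intro2 _ _ y Cy erefl)); lra.
Qed.

(** A functional whose real part is bounded below on the differences between the
   hull of [A] and the span of [s] vanishes on that span. Dividing it by its limit along [U], whose
   modulus is at least [d], gives [f]. *)
Lemma annihilating_functional (C : set X) (U : set_system X) B d s A :
  UltraFilter U -> U C -> (forall c, C c -> rnorm c <= B) -> 0 < d -> U A ->
  (forall a u, rhull A a -> span_seq s u -> d <= rnorm (a - u)) ->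
  exists f : dual X, [/\ bounded_by d^-1 f, forall v, v \in s -> dual_fun f v = 0 &
    forall e, 0 < e -> U [set x | rnorm (dual_fun f x - 1) <= e]].
Proof.
move=> UU UC CB d0 UA gap.
have [a0 Aa0] := filter_ex UA.
pose D := [set x | exists2 a, rhull A a & exists2 u, span_seq s u & x = a - u].
have Du a u : A a -> span_seq s u -> D (a - u).
  by move=> Aa su; exists a; [exact: sub_rhull|exists u].
have [|||f f1 fD] := @separation _ _ X D d.
- by exists (a0 - 0); apply: Du => //; exact: span_seq0.
- move=> _ _ p t [a Aa [u su ->]] [b Ab [v sv ->]] p0 t0 pt.
  exists (emb p *: a + emb t *: b); first exact: rhull_convex.
  exists (emb p *: u + emb t *: v); last by rewrite !scalerBr addrACA -opprD.
  by apply: span_seq_lin => //; exact: span_seqZ.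
- by move=> _ [a Aa [u su ->]]; exact: gap.
have fspan u : span_seq s u -> dual_fun f u = 0.
  move=> su; apply: contrapT => /eqP fu0.
  (* This multiple of [u] makes the real part vanish, contrary to the bound [d]. *)
  pose M := emb (realpart (dual_fun f a0)) : K.
  have := fD _ (Du a0 ((M / dual_fun f u) *: u) Aa0 (span_seqZ _ su)).
  by rewrite dual_funB dual_funZ divfK// raddfB/= embK subrr leNgt d0.
have fB x : C x -> rnorm (dual_fun f x) <= B.
  by move=> /CB; have := f1 x; rewrite mul1r; exact: le_trans.
have [c cP] := ultra_limit UU UC fB.
have dc : d <= realpart c.
  rewrite leNgt; apply/negP => cd.
  have e0 : 0 < (d - realpart c) / 2 by lra.
  have [x [/= Ax xc]] := filter_ex (filterI UA (cP _ e0)).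
  have := fD _ (Du x 0 Ax (span_seq0 s)); rewrite subr0.
  by have := realpart_le_rnorm (dual_fun f x - c); rewrite raddfB/=; lra.
have rc : d <= rnorm (c : K^o) by rewrite (le_trans dc)// realpart_le_rnorm.
have c0 : c != 0 by rewrite -(@rnorm_eq0 R k K^o) gt_eqF// (lt_le_trans d0).
have rci : rnorm (c^-1 : K^o) = (rnorm (c : K^o))^-1.
  apply: (mulfI (_ : rnorm (c : K^o) != 0)); first by rewrite rnorm_eq0.
  by rewrite -rnormM !divff ?rnorm1// rnorm_eq0.
have rcd : rnorm (c^-1 : K^o) <= d^-1.
  by rewrite rci ler_pV2// inE unitfE ?gt_eqF//= (lt_le_trans d0).
have [g gE gB] := dual_scale c^-1 f1.
exists g; split=> [x|v vs|e e0].
- rewrite (le_trans (gB x))// mulr1 ler_wpM2r ?rnorm_ge0//.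
- by rewrite gE fspan ?mulr0//; exact: mem_span_seq.
have de0 : 0 < d * e by exact: mulr_gt0.
apply: filterS (cP _ de0) => x /= xc.
rewrite gE -(mulVf c0) -mulrBr rnormM.
rewrite (le_trans (ler_wpM2r (rnorm_ge0 _) rcd))//.
by rewrite ler_pdivrMl.
Qed.

(** At each step [f j] is chosen to annihilate the preceding terms of [x] and to
   have limit 1 along the ultrafilter, and then [x j] in [C] is chosen so that all
   functionals chosen up to now are close to 1 at it. *)
Lemma james_sequence (C : set X) (eps : nat -> R) :
  bounded_closed_convex C -> ~ weakly_compact C -> (forall n, 0 < eps n) ->
  exists (x : nat -> X) (f : nat -> dual X) (L : R),
    [/\ forall n, C (x n), forall n, bounded_by L (f n),
        forall i j, (i < j)%N -> dual_fun (f j) (x i) = 0 &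
        forall i j, (j <= i)%N -> rnorm (dual_fun (f j) (x i) - 1) <= eps i].
Proof.
move=> bcC; have [_ /bounded_rnorm[B B0 CB] _ _] := bcC.
rewrite /weakly_compact compact_ultra => nC eps0.
have [U [UU UC Ucvg]] : exists U : set_system X, [/\ UltraFilter U, U C &
    forall p, C p -> ~ (U : set_system (weak X)) --> (p : weak X)].
  apply: contrapT => nU; apply: nC => U UU UC; apply: contrapT => np; apply: nU.
  by exists U; split=> // p Cp Up; apply: np; exists p.
have [d d0 gap] := ultra_hull_gap bcC UU UC Ucvg.
have [f0 _ _] := norming (0 : X).
pose near1 (f : dual X) := forall e, 0 < e -> U [set x | rnorm (dual_fun f x - 1) <= e].
pose t0 : X * dual X := (0, f0).
have [|t tP] := @choice_history (X * dual X) (fun h t =>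
  [/\ C t.1, bounded_by d^-1 t.2, near1 t.2,
    forall i, (i < size h)%N -> dual_fun t.2 (nth t0 h i).1 = 0 &
    rnorm (dual_fun t.2 t.1 - 1) <= eps (size h) /\
    forall i, (i < size h)%N -> near1 (nth t0 h i).2 ->
      rnorm (dual_fun (nth t0 h i).2 t.1 - 1) <= eps (size h)]).
  move=> h; have [A UA Agap] := gap (map fst h).
  have [f [fd fv fU]] := annihilating_functional UU UC CB d0 UA Agap.
  have Uh e : 0 < e -> U [set x | forall i, (i < size h)%N -> near1 (nth t0 h i).2 ->
      rnorm (dual_fun (nth t0 h i).2 x - 1) <= e].
    move=> e0; elim: h {fv Agap} => [|t h IH]; first exact: filterS (@filterT _ U _).
    have [tn|tn] := pselect (near1 t.2).
      by apply: filterS2 IH (tn _ e0) => x /= xh xt [|i]//=; exact: xh.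
    by apply: filterS IH => x /= xh [|i]//=; exact: xh.
  have e0 := eps0 (size h).
  have [x [Cx [fx hx]]] := filter_ex (filterI UC (filterI (fU _ e0) (Uh _ e0))).
  exists (x, f); split=> //= i ih; apply: fv.
  by rewrite -(nth_map _ 0) ?mem_nth ?size_map.
exists (fun n => (t n).1), (fun n => (t n).2), d^-1.
split=> [n|n|i j ij|i j].
- by case: (tP n).
- by case: (tP n).
- by have [_ _ _ + _] := tP j; move=> /(_ i); rewrite size_mkseq nth_mkseq//; apply.
rewrite leq_eqVlt => /predU1P[->|ji].
  by have [_ _ _ _ []] := tP i; rewrite size_mkseq.
have [_ _ jn _ _] := tP j; have [_ _ _ _ [_ /(_ j)]] := tP i.
by rewrite size_mkseq nth_mkseq//; apply.
Qed.

End James.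

(** * Weakly unconditionally Cauchy series *)

Section WeaklyUnconditionallyCauchy.
Context {R : realType} {k : scalar_kind}.
Local Notation K := (scalars R k).
Variables (X : normedModType K) (y : nat -> X).

Definition abs_sum (g : X -> R) (N : nat) := \sum_(l < N) `|g (y l)|.

Lemma abs_sumD g h N : abs_sum (fun x => g x + h x) N <= abs_sum g N + abs_sum h N.
Proof. by rewrite /abs_sum -big_split/= ler_sum// => i _; exact: ler_normD. Qed.

Lemma abs_sumZ c g N : abs_sum (fun x => c * g x) N = `|c| * abs_sum g N.
Proof. by rewrite /abs_sum mulr_sumr; apply: eq_bigr => i _; rewrite normrM. Qed.

Lemma abs_sum_norm g N : (forall x, `|g x| <= rnorm x) ->
  abs_sum g N <= \sum_(l < N) rnorm (y l).
Proof. by move=> g1; rewrite /abs_sum ler_sum. Qed.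

(** One of [g + h] and [g - h] is at least as large as [h], by the triangle
   inequality for their difference. *)
Lemma abs_sum_sign g h N : exists2 s : R, `|s| = 1 &
  abs_sum h N <= abs_sum (fun x => g x + s * h x) N.
Proof.
have H : 2 * abs_sum h N <= abs_sum (fun x => g x + 1 * h x) N +
    abs_sum (fun x => g x + (-1) * h x) N.
  rewrite /abs_sum mulr_sumr -big_split/= ler_sum// => i _.
  rewrite mul1r mulN1r (le_trans _ (ler_normB _ _))//.
  have -> : g (y i) + h (y i) - (g (y i) - h (y i)) = 2 * h (y i) by ring.
  by rewrite normrM ger0_norm.
have [H1|H1] := leP (abs_sum h N) (abs_sum (fun x => g x + 1 * h x) N).
  by exists 1; rewrite ?normr1.
by exists (-1); rewrite ?normrN1//; lra.
Qed.

Let F (t : nat -> (X -> R) * nat * R) n x := \sum_(i < n) (t i).2 * (t i).1.1 x.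

(** Gliding hump. If the sums were unbounded on the unit ball of the dual, then a
   geometric series of functionals, each chosen to beat the preceding partial sum
   at some stage and scaled so as not to spoil the earlier stages, would converge
   to a functional on which they are infinite. *)
Lemma abs_sum_uniform :
  (forall g, real_linear g -> (forall x, `|g x| <= rnorm x) ->
     exists M, forall N, abs_sum g N <= M) ->
  exists M, forall g, real_linear g -> (forall x, `|g x| <= rnorm x) ->
    forall N, abs_sum g N <= M.
Proof.
move=> ptw; apply: contrapT => nunif.
have big M : exists g N, [/\ real_linear g, forall x, `|g x| <= rnorm x & M < abs_sum g N].
  apply: contrapT => nM; apply: nunif; exists M => g lg g1 N.
  by rewrite leNgt; apply/negP => MN; apply: nM; exists g, N.
pose w n : R := (2 ^+ n.+1)^-1.
have w0 n : 0 < w n by rewrite invr_gt0 exprn_gt0.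
have wS n : w n.+1 = w n / 2 by rewrite /w [in LHS]exprS invfM mulrC.
have [g0 [_ [lg0 g01 _]]] := big 0.
pose t0 : (X -> R) * nat * R := (g0, 0%N, 0).
pose S N := \sum_(l < N) rnorm (y l).
have S0 N : 0 <= S N by apply: sumr_ge0 => i _; exact: rnorm_ge0.
have [|t tP] := @choice_history _ (fun h (t : (X -> R) * nat * R) =>
  [/\ real_linear t.1.1, forall x, `|t.1.1 x| <= rnorm x, `|t.2| <= w (size h),
    forall i, (i < size h)%N -> `|t.2| * S (nth t0 h i).1.2 <= w (size h) &
    (size h)%:R <= abs_sum (fun x => F (nth t0 h) (size h) x + t.2 * t.1.1 x) t.1.2]).
  move=> h; set n := size h; pose Q := \sum_(i < n) S (nth t0 h i).1.2.
  have Q0 : 0 <= Q by exact: sumr_ge0.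
  (* The factor [al] keeps the sums up to the earlier stages almost unchanged. *)
  pose al := w n / (1 + Q); have al0 : 0 < al by rewrite divr_gt0//; lra.
  have [g [N [lg g1 gN]]] := big (n%:R / al).
  have [s s1 sP] := abs_sum_sign (F (nth t0 h) n) (fun x => al * g x) N.
  have sal : `|s * al| = al by rewrite normrM s1 mul1r gtr0_norm.
  have alQ : al * (1 + Q) = w n by rewrite divfK// gt_eqF//; lra.
  exists (g, N, s * al); split=> //=; rewrite ?sal//.
  - by have := w0 n; nra.
  - move=> i ni; rewrite -alQ ler_wpM2l ?(ltW al0)//.
    rewrite /Q (bigD1 (Ordinal ni))//= addrCA lerDl addr_ge0//.
    exact: sumr_ge0.
  - apply: (@le_trans _ _ (abs_sum (fun x => al * g x) N)).
      rewrite abs_sumZ gtr0_norm// mulrC -ler_pdivrMr//; exact: ltW.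
    by apply: (le_trans sP); apply: ler_sum => i _; rewrite mulrA.
have FS n x : F t n.+1 x = F t n x + (t n).2 * (t n).1.1 x.
  by rewrite /F big_ord_recr.
have tF n : F (nth t0 (mkseq t n)) n = F t n.
  by apply/funext => x; apply: eq_bigr => i _; rewrite nth_mkseq.
(* The later terms of the series take away less than 1 from the hump at [m]. *)
have hump m n : (m < n)%N -> m%:R - 1 + w n * 2 <= abs_sum (F t n) (t m).1.2.
  elim: n => // n IH; rewrite ltnS leq_eqVlt => /predU1P[->|mn].
    have [_ _ _ _] := tP n; rewrite size_mkseq tF.
    have -> : (fun x => F t n x + (t n).2 * (t n).1.1 x) = F t n.+1.
      by apply/funext => x; rewrite FS.
    have : w n <= 1 by rewrite /w invf_le1 ?exprn_gt0// exprn_ege1// ler1n.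
    by have := wS n; lra.
  have [_ tn1 _ /(_ m)] := tP n; rewrite size_mkseq nth_mkseq// => /(_ mn) tS _.
  have E : F t n = (fun x => F t n.+1 x + (- (t n).2) * (t n).1.1 x).
    by apply/funext => x; rewrite FS mulNr addrK.
  have := IH mn; rewrite {1}E => /le_trans/(_ (abs_sumD _ _ _)).
  rewrite abs_sumZ normrN.
  have := ler_wpM2l (normr_ge0 (t n).2) (abs_sum_norm (t m).1.2 tn1).
  by rewrite -/(S _); have := wS n; have := w0 n; lra.
have Fcv x : cvgn (fun n => F t n x).
  have -> : (fun n => F t n x) = series (fun i => (t i).2 * (t i).1.1 x).
    by apply/funext => n; rewrite /series/= big_mkord.
  apply: normed_cvg; apply: (@series_le_cvg _ _ (geometric (rnorm x / 2) 2^-1)) => //=.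
  - by move=> n; rewrite mulr_ge0 ?divr_ge0 ?rnorm_ge0// exprn_ge0// invr_ge0.
  - move=> n; have [_ tn1 tnw _ _] := tP n; rewrite size_mkseq in tnw.
    rewrite normrM mulrC -mulrA -exprS exprVn; apply: ler_pM => //.
  - by apply: is_cvg_geometric_series; rewrite ger0_norm ?invr_ge0// invf_lt1// ltr1n.
pose G x := limn (fun n => F t n x).
have lF n : real_linear (F t n).
  elim: n => [|n [IH1 IH2]]; first by split=> *; rewrite /F !big_ord0 ?addr0 ?mulr0.
  have [[lt1 lt2] _ _ _ _] := tP n.
  split=> [u v|r u]; rewrite !FS ?IH1 ?IH2 ?lt1 ?lt2; first by rewrite mulrDr addrACA.
  by rewrite mulrDr mulrCA.
have lG : real_linear G.
  split=> [u v|r u].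
    apply: cvg_lim => //; under eq_fun do rewrite (lF _).1.
    by apply: cvgD; exact: Fcv.
  apply: cvg_lim => //; under eq_fun do rewrite (lF _).2.
  by apply: cvgMl_tmp; exact: Fcv.
have F1 n x : `|F t n x| <= (1 - w n * 2) * rnorm x.
  elim: n => [|n IH].
    by rewrite /F big_ord0 normr0 /w expr1 mulVf// subrr mul0r.
  have [_ tn1 tnw _ _] := tP n; rewrite size_mkseq in tnw.
  rewrite FS (le_trans (ler_normD _ _))// normrM.
  have := ler_pM (normr_ge0 _) (normr_ge0 _) tnw (tn1 x).
  by have := wS n; nra.
have G1 x : `|G x| <= rnorm x.
  rewrite ler_norml; apply/andP; split.
    apply: limr_ge; first exact: Fcv.
    near=> n; have := F1 n x; rewrite ler_norml => /andP[+ _]; apply: le_trans.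
    by have := rnorm_ge0 x; have := w0 n; nra.
  apply: limr_le; first exact: Fcv.
  near=> n; have := F1 n x; rewrite ler_norml => /andP[_]; move/le_trans; apply.
  by have := rnorm_ge0 x; have := w0 n; nra.
have [M MP] := ptw G lG G1.
have sumcv N : (fun n => abs_sum (F t n) N) @ \oo --> abs_sum G N.
  elim: N => [|N IH].
    rewrite /abs_sum big_ord0; under eq_fun do rewrite big_ord0.
    exact: cvg_cst.
  rewrite /abs_sum big_ord_recr/=; under eq_fun do rewrite big_ord_recr/=.
  by apply: cvgD => //; apply: cvg_norm; exact: Fcv.
have Gm m : m%:R - 1 <= M.
  apply: le_trans (MP (t m).1.2).
  rewrite -(cvg_lim _ (sumcv (t m).1.2))//.
  apply: limr_ge; first by apply/cvg_ex; eexists; exact: sumcv.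
  near=> n; apply: (@le_trans _ _ (m%:R - 1 + w n * 2)); first by have := w0 n; lra.
  by apply: hump; near: n; exact: nbhs_infty_gt.
have := Gm (Num.truncn (`|M| + 1)).+1.
have := truncnS_gt (`|M| + 1); have := ler_norm M.
move: (_.+1%:R) => a; lra.
Unshelve. all: by end_near. Qed.

(** Norming the sum by a functional [f] bounds it by [A] times the sum of the moduli
   of the values [f (y i)], which [abs_sum_uniform] controls through the real
   parts of [f] and [w * f]. *)
Lemma wuc_bound :
  (forall f : dual X, (\sum_(0 <= n <oo) (rnorm (dual_fun f (y n)))%:E < +oo)%E) ->
  exists2 M, 0 <= M & forall n (a : nat -> K) A, 0 <= A ->
    (forall i, (i < n)%N -> rnorm (a i : K^o) <= A) ->
    rnorm (\sum_(i < n) a i *: y i) <= M * A.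
Proof.
move=> wuc.
have [g lg g1|M MP] := abs_sum_uniform.
  have [x|f _ fg] := real_dual (C := 1) lg.
    by rewrite mul1r (le_trans _ (g1 x))// ler_norm.
  have := wuc f; set s := (\sum_(0 <= n <oo) _)%E => sfin.
  have s0 : (0 <= s)%E by apply: nneseries_ge0 => n _ _; rewrite lee_fin rnorm_ge0.
  exists (fine s) => N; rewrite -lee_fin fineK ?ge0_fin_numE//.
  apply: (@le_trans _ _ (\sum_(0 <= i < N) (rnorm (dual_fun f (y i)))%:E)%E).
    rewrite sumEFin lee_fin big_mkord; apply: ler_sum => i _.
    by rewrite -fg realpart_le.
  by apply: nneseries_lim_ge => n _ _; rewrite lee_fin rnorm_ge0.
have M0 : 0 <= M.
  have l0 : real_linear (fun _ : X => 0 : R) by split=> *; rewrite ?addr0 ?mulr0.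
  have := MP _ l0 _ 0%N; rewrite /abs_sum big_ord0; apply=> x.
  by rewrite normr0 rnorm_ge0.
have fM (f : dual X) N : bounded_by 1 f ->
    \sum_(i < N) `|realpart (dual_fun f (y i))| <= M.
  move=> f1; apply: (MP (fun x => realpart (dual_fun f x))).
    split=> [u v|r u]; first by rewrite dual_funD raddfD.
    by rewrite dual_funZ realpart_embM.
  by move=> x; rewrite (le_trans (realpart_le _))// (le_trans (f1 x))// mul1r.
have [w w1 wP] := @second_direction R k.
exists (2 * M) => [|n a A A0 aA]; first by rewrite mulr_ge0.
have [f f1 fn] := norming (\sum_(i < n) a i *: y i).
have [g gE g1] := unimodular_scale f1 w1.
apply: (le_trans fn); rewrite (le_trans (realpart_le_rnorm _))//.
rewrite dual_fun_sum.
apply: (le_trans (@rnorm_sum R k K^o n (fun i => a i * dual_fun f (y i)))).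
apply: (@le_trans _ _ (\sum_(i < n) A * (`|realpart (dual_fun f (y i))| +
    `|realpart (dual_fun g (y i))|))).
  apply: ler_sum => i _; rewrite rnormM gE.
  by apply: ler_pM; rewrite ?rnorm_ge0 ?aA.
rewrite -mulr_sumr big_split/= mulrC ler_wpM2r//.
by have := fM f n f1; have := fM g n g1; lra.
Qed.

End WeaklyUnconditionallyCauchy.

(** * A Ramsey theorem and independence *)

Section Ramsey.

Definition inf_set (D : set nat) := forall n, exists2 m, (n <= m)%N & D m.

Definition branch (D : set nat) (N : nat -> nat) :=
  (forall i, (N i < N i.+1)%N) /\ (forall i, D (N i)).

Lemma branch_homo D N : branch D N -> {homo N : i j / (i < j)%N}.
Proof. by move=> [Ni _]; apply: homo_ltn => //; exact: ltn_trans. Qed.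

Lemma branch_mono D N : branch D N -> {mono N : i j / (i <= j)%N}.
Proof. by move=> /branch_homo; exact: leq_mono. Qed.

Lemma branch_ge D N i : branch D N -> (i <= N i)%N.
Proof.
by move=> bN; elim: i => // i /leq_ltn_trans; apply; exact: (branch_homo bN).
Qed.

Lemma branch_inf D N : branch D N -> inf_set (range N).
Proof. by move=> bN n; exists (N n); [exact: branch_ge bN|exists n]. Qed.

Lemma thin_branch D (b : nat -> nat) : inf_set D ->
  exists2 N, branch D N & forall i, (b (N i) <= N i.+1)%N.
Proof.
move=> iD; have [next nextP] : {next & forall n, (n <= next n)%N /\ D (next n)}.
  apply: (@choice _ _ (fun n m => (n <= m)%N /\ D m)) => n.
  by have [m nm Dm] := iD n; exists m.
pose N := fix N i := if i is i'.+1 then next (maxn (N i').+1 (b (N i'))) else next 0%N.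
have NS i : (maxn (N i).+1 (b (N i)) <= N i.+1)%N by exact: (nextP _).1.
exists N => [|i]; last by rewrite (leq_trans _ (NS i))// leq_maxr.
split=> [i|[|i]]; [|exact: (nextP _).2|exact: (nextP _).2].
by rewrite (leq_trans _ (NS i))// leq_maxl.
Qed.

(** Properties of infinite sets that pass to almost contained infinite sets can
   be achieved simultaneously, countably many at a time: one takes the successive
   elements in a decreasing sequence of sets. *)
Lemma diagonal (I : countType) (Q : I -> set nat -> Prop) :
  (forall i M D p, Q i M -> (forall n, (p <= n)%N -> D n -> M n) ->
     inf_set D -> Q i D) ->
  (forall i M, inf_set M -> exists D, [/\ D `<=` M, inf_set D & Q i D]) ->
  forall M, inf_set M -> exists D, [/\ D `<=` M, inf_set D & forall i, Q i D].
Proof.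
move=> Qher Qden M iM.
pose Q' k D := forall i, pickle i = k -> Q i D.
have Q'den (kM : nat * set nat) : exists D, inf_set kM.2 ->
    [/\ D `<=` kM.2, inf_set D & Q' kM.1 D].
  case: kM => k E /=; have [iE|nE] := pselect (inf_set E); last by exists E.
  have [[i ik]|ni] := pselect (exists i : I, pickle i = k).
    have [D [DE iD QD]] := Qden i E iE; exists D => _; split=> // j.
    by rewrite -ik => /(pcan_inj pickleK) ->.
  by exists E => _; split=> // i ik; case: ni; exists i.
have [F FP] := choice Q'den.
pose Ms := fix Ms k := if k is k'.+1 then F (k', Ms k') else M.
have iMs k : inf_set (Ms k) by elim: k => //= k /(FP (k, Ms k))[].
have MsS k : Ms k.+1 `<=` Ms k by case: (FP (k, Ms k) (iMs k)).
have Ms_sub j k : (j <= k)%N -> Ms k `<=` Ms j.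
  elim: k => [|k IH]; first by rewrite leqn0 => /eqP ->.
  rewrite leq_eqVlt => /predU1P[->//|]; rewrite ltnS => /IH.
  exact: (subset_trans (MsS k)).
have [nx nxP] : {nx : nat * nat -> nat & forall kp, (kp.2 <= nx kp)%N /\ Ms kp.1 (nx kp)}.
  apply: (@choice _ _ (fun kp n => (kp.2 <= n)%N /\ Ms kp.1 n)) => -[k p] /=.
  by have [m pm Mm] := iMs k p; exists m.
pose N := fix N i := if i is i'.+1 then nx (i'.+2, (N i').+1) else nx (1%N, 0%N).
have NM i : Ms i.+1 (N i) by case: i => [|i]; exact: (nxP (_, _)).2.
have bN : branch setT N by split=> // i; exact: (nxP (_, _)).1.
exists (range N); split; [|exact: branch_inf bN|].
  by move=> _ [i _ <-]; exact: (Ms_sub 0%N _ _ (N i) (NM i)).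
move=> i; apply: (Qher i (Ms (pickle i).+1) _ (N (pickle i))).
- by case: (FP (pickle i, Ms (pickle i)) (iMs _)) => _ _; exact.
- move=> _ /[swap] -[j _ <-]; rewrite (branch_mono bN) => ij.
  exact: (Ms_sub _ _ _ _ (NM j)).
- exact: branch_inf bN.
Qed.

Variable G : seq nat -> Prop.

Let accept s (D : set nat) := exists p, forall N, branch D N -> (p <= N 0%N)%N ->
  exists k, ~ G (s ++ mkseq N k).

Let reject s (D : set nat) := forall M, M `<=` D -> inf_set M ->
  exists2 N, branch M N & forall k, G (s ++ mkseq N k).

(** Galvin's lemma, a Ramsey theorem for open families of infinite sets. One
   first passes to an infinite set [D] on which every finite sequence [s] is
   decided: either all branches far enough in [D] make [s] leave [G], or every
   infinite subset of [D] has a branch along which [s] stays in [G]. The second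
   alternative is inherited by almost all one-point extensions of [s]. *)
Lemma galvin (M : set nat) : inf_set M ->
  (forall M', M' `<=` M -> inf_set M' ->
     exists2 N, branch M' N & forall k, G (mkseq N k)) ->
  exists2 N, branch M N & forall n s, subseq s (mkseq N n) -> G s.
Proof.
move=> iM GM.
have [|s M' iM'|D [DM iD decD]] :=
  @diagonal (seq nat) (fun s D => accept s D \/ reject s D) _ _ M iM.
- move=> s M' D p [[q qP]|rs] pDM iD; [left|right].
    exists (maxn p q) => N [Ni ND] pN; apply: qP; last by rewrite (leq_trans _ pN)// leq_maxr.
    split=> // i; apply: pDM => //; rewrite (leq_trans (leq_trans (leq_maxl p q) pN))//.
    by rewrite (@branch_mono D).
  move=> E ED iE; have [||N [Ni NE] GN] := rs (E `&` M').
  + exact: subIsetr.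
  + move=> n; have [m] := iE (maxn n p); rewrite geq_max => /andP[nm pm] Em.
    by exists m => //; split=> //; exact/pDM/ED.
  + by exists N => //; split=> // i; case: (NE i).
- have [rs|nrs] := pselect (reject s M'); first by exists M'; split=> //; right.
  suff [E [EM iE EN]] : exists E, [/\ E `<=` M', inf_set E &
      forall N, branch E N -> exists k, ~ G (s ++ mkseq N k)].
    by exists E; split=> //; left; exists 0%N => N /EN.
  apply: contrapT => nE; apply: nrs => E EM iE; apply: contrapT => nN; apply: nE.
  exists E; split=> // N bN; apply: contrapT => nk; apply: nN.
  by exists N => // k; apply: contrapT => Gk; apply: nk; exists k.
have ext s : reject s D -> exists p, forall n, (p <= n)%N -> D n -> reject (rcons s n) D.
  move=> rs; apply: contrapT => np.
  pose E := [set n | D n /\ ~ reject (rcons s n) D].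
  have iE : inf_set E.
    move=> n; apply: contrapT => nm; apply: np; exists n => m nm' Dm.
    by apply: contrapT => nr; apply: nm; exists m.
  have [b bP] : {b : nat -> nat & forall n, E n -> forall N, branch D N ->
      (b n <= N 0%N)%N -> exists k, ~ G (rcons s n ++ mkseq N k)}.
    apply: (@choice _ _ (fun n p => E n -> forall N, branch D N ->
      (p <= N 0%N)%N -> exists k, ~ G (rcons s n ++ mkseq N k))) => n.
    have [En|nE] := pselect (E n); last by exists 0%N.
    by have [[p pP]|/(proj2 En)//] := decD (rcons s n); exists p.
  have [N0 bN0 N0b] := thin_branch b iE.
  have [||N bN GN] := rs (range N0).
  - by move=> _ [i _ <-]; exact: (proj1 (bN0.2 i)).
  - exact: branch_inf bN0.
  have [i _ Ni] := bN.2 0%N.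
  have bN' : branch D (fun j => N j.+1).
    split=> j; first exact: bN.1.
    by have [l _ <-] := bN.2 j.+1; exact: (proj1 (bN0.2 l)).
  have EN0 : E (N 0%N) by rewrite -Ni; exact: bN0.2.
  have [|k] := bP _ EN0 _ bN'.
    have [l _ Nl] := bN.2 1%N; have := bN.1 0%N; rewrite -Ni -Nl => lt.
    rewrite (leq_trans (N0b i))// (branch_mono bN0) ltnNge.
    by apply/negP => li; move: lt; rewrite ltnNge (branch_mono bN0) li.
  apply; rewrite cat_rcons; have := GN k.+1; congr (G (s ++ _)).
  rewrite /mkseq /= -[1%N]addn0 iotaDl -map_comp; congr cons.
have [p pP] : {p : seq nat -> nat & forall s, reject s D ->
    forall n, (p s <= n)%N -> D n -> reject (rcons s n) D}.
  apply: (@choice _ _ (fun s p => reject s D -> forall n, (p <= n)%N -> D n ->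
    reject (rcons s n) D)) => s.
  have [/ext[p pP]|nr] := pselect (reject s D); first by exists p.
  by exists 0%N.
have [h|N NP] := @choice_history nat (fun h n =>
   [/\ D n, forall x, x \in h -> (x < n)%N &
     forall m : (size h).-tuple bool, (p (mask m h) <= n)%N]).
  have [n] := iD (maxn (\max_(x <- h) x.+1) (\max_(m : (size h).-tuple bool) p (mask m h))).
  rewrite geq_max => /andP[/bigmax_leqP_seq hn /bigmax_leqP pn] Dn.
  exists n; split=> // [x xh|m]; [exact: hn|exact: pn].
have bN : branch D N.
  split=> i; last by case: (NP i).
  have [_ + _] := NP i.+1; apply.
  by rewrite mkseqS mem_rcons inE eqxx.
have rN n s : subseq s (mkseq N n) -> reject s D.
  elim: n s => [|n IH] s.
    rewrite subseq0 => /eqP -> E ED iE; apply: GM => //; exact: subset_trans DM.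
  rewrite mkseqS => /subseqP[m + ->]; rewrite size_rcons; case/lastP: m => [|m b]//.
  rewrite size_rcons => -[sm]; rewrite mask_rcons//.
  have rm : reject (mask m (mkseq N n)) D by apply: IH; exact: mask_subseq.
  case: b; last by rewrite cats0.
  rewrite cats1; apply: pP => //; last by case: (NP n).
  have [_ _ /(_ (Tuple (introT eqP sm)))] := NP n; exact.
exists N => [|n s /rN rs]; first by split; [exact: bN.1|move=> i; exact/DM/bN.2].
by have [|N' _ /(_ 0%N)] := rs D (fun _ => id); rewrite ?cats0.
Qed.

End Ramsey.

(** Galvin's lemma yields finite sequences of indices met alternately by [A] and
   [B]. Keeping the middle one of three consecutive indices leaves room to adjust
   the parity, so that either of the two sets can be prescribed at it. *)
Lemma independent_pairs (T : Type) (A B : nat -> T -> Prop) (M : set nat) :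
  inf_set M ->
  (forall M', M' `<=` M -> inf_set M' -> exists f,
     inf_set [set m | M' m /\ A m f] /\ inf_set [set m | M' m /\ B m f]) ->
  exists2 t, branch M t & forall n (th : nat -> bool), exists f,
    forall i, (i < n)%N -> if th i then A (t i) f else B (t i) f.
Proof.
move=> iM io.
pose G s := exists f, forall i, (i < size s)%N ->
  if odd i then B (nth 0%N s i) f else A (nth 0%N s i) f.
have [M' M'M iM'|N bN GN] := @galvin G M iM.
  have [f [Af Bf]] := io M' M'M iM'.
  have [nx nxP] : {nx : bool * nat -> nat & forall bp, [/\ (bp.2 <= nx bp)%N, M' (nx bp) &
      if bp.1 then B (nx bp) f else A (nx bp) f]}.
    apply: (@choice _ _ (fun bp n => [/\ (bp.2 <= n)%N, M' n &
      if bp.1 then B n f else A n f])) => -[[] p] /=.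
      by have [m pm [Mm Bm]] := Bf p; exists m.
    by have [m pm [Mm Am]] := Af p; exists m.
  pose N := fix N i := if i is i'.+1 then nx (odd i, (N i').+1) else nx (false, 0%N).
  exists N => [|k].
    split=> i; first by case: (nxP (odd i.+1, (N i).+1)).
    by case: i => [|i]; [case: (nxP (false, 0%N))|case: (nxP (odd i.+1, (N i).+1))].
  exists f => i; rewrite size_mkseq => ik; rewrite nth_mkseq//.
  case: i {ik} => [|i]; first by case: (nxP (false, 0%N)).
  by case: (nxP (odd i.+1, (N i).+1)).
(* The length of [sel n] is [2 * n]. According to [th i], the index with number
   [3 * i + 1] gets an even or an odd position in it. *)
exists (fun i => N (3 * i).+1) => [|n th].
  by split=> i; [apply: (branch_homo bN); lia|exact: bN.2].
pose sel := fix sel n := if n is n'.+1 then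
  sel n' ++ (if th n' then [:: N (3 * n').+1; N (3 * n').+2]
             else [:: N (3 * n')%N; N (3 * n').+1]) else [::].
have size_sel m : size (sel m) = (2 * m)%N.
  by elim: m => //= m IH; rewrite size_cat IH; case: (th m) => /=; lia.
have sub_sel m : subseq (sel m) (mkseq N (3 * m)).
  elim: m => // m IH; have -> : (3 * m.+1 = 3 * m + 3)%N by lia.
  rewrite /mkseq iotaD map_cat; apply: cat_subseq => //; rewrite add0n.
  case: (th m); first exact: subseq_cons.
  exact: (prefix_subseq [:: _; _] [:: _]).
have [f fP] := GN _ _ (sub_sel n).
exists f => i ni; have nth_sel m e : (i < m)%N -> (e < 2)%N ->
    nth 0%N (sel m) (2 * i + e) = N (3 * i + e + th i)%N.
  move=> im e2; elim: m im => // m IH; rewrite ltnS leq_eqVlt /= nth_cat size_sel.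
  case: (ltnP i m) => im; last first.
    rewrite orbF => /eqP ?; subst m; rewrite ltnNge leq_addr/= addKn.
    by case: e e2 {IH} => [|[|]]// _; case: (th i) => /=; congr N; lia.
  by move=> _; rewrite (_ : (_ < _)%N = true) ?IH//; lia.
have := fP (2 * i + ~~ th i)%N; rewrite size_sel.
rewrite oddD oddM/= nth_sel//; last by case: (th i).
case: (th i) => /=; rewrite ?addn0 ?addn1; apply; lia.
Qed.

(** * Rosenthal's l1 theorem *)

Section Rosenthal.
Context {R : realType} {k : scalar_kind}.
Local Notation K := (scalars R k).

Lemma l1_norm_unit_vector n (a : nat -> K) :
  l1_norm (\sum_(i < n) a i *: @unit_vector R k i) =
  (\sum_(i < n) rnorm (a i : K^o))%:E.
Proof.
have E j : (\sum_(i < n) a i *: @unit_vector R k i) j = if (j < n)%N then a j else 0.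
  rewrite fct_sumE; elim: n => [|n IH]; first by rewrite big_ord0.
  rewrite big_ord_recr/= IH.
  have -> : (a n *: @unit_vector R k n) j = a n * (j == n)%:R :> K by [].
  by rewrite ltnS; case: (ltngtP j n) => [_|_|->]; rewrite ?mulr1 ?mulr0 ?addr0 ?add0r.
rewrite /l1_norm (nneseries_split 0 n)/=; last first.
  by move=> i _; rewrite lee_fin rnorm_ge0.
rewrite add0n eseries0 ?adde0.
  rewrite sumEFin big_mkord; congr EFin; apply: eq_bigr => i _.
  by rewrite E ltn_ord.
by move=> i ni _; rewrite E ltnNge ni/= rnorm0.
Qed.

Variable X : normedModType K.

Lemma rnorm_comb_le (x : nat -> X) B n (a : nat -> K) :
  (forall i, rnorm (x i) <= B) ->
  rnorm (\sum_(i < n) a i *: x i) <= B * \sum_(i < n) rnorm (a i : K^o).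
Proof.
move=> xB; apply: (le_trans (rnorm_sum n (fun i => a i *: x i))).
rewrite mulr_sumr ler_sum// => i _.
by rewrite rnormZ mulrC ler_wpM2r ?rnorm_ge0.
Qed.

(** Values in two small discs that are far apart, prescribed independently along
   the sequence, give the lower l1 estimate. For complex coefficients the discs
   have to be small compared with their distance: choosing one disc or the other
   according to the signs of the real parts of [a i], or of [w * a i], makes the
   main term at least half of the l1 norm, and the radii only contribute an error
   proportional to that norm. *)
Lemma l1_lower_bound (x : nat -> X) (p q : K) r :
  0 < r -> 14 * r <= rnorm (p - q : K^o) ->
  (forall n (th : nat -> bool), exists2 f : dual X, bounded_by 1 f &
    forall i, (i < n)%N ->
      rnorm (dual_fun f (x i) - (if th i then p else q) : K^o) <= r) ->
  forall n (a : nat -> K), 5 * r * \sum_(i < n) rnorm (a i : K^o) <=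
    2 * rnorm (\sum_(i < n) a i *: x i).
Proof.
move=> r0 pq ind n a; set S := \sum_(i < n) _; set u := \sum_(i < n) _.
have [w w1 wP] := @second_direction R k.
have [v v1 vS] : exists2 v : K, rnorm (v : K^o) = 1 &
    S <= 2 * \sum_(i < n) `|realpart (v * a i)|.
  have SS : S <= \sum_(i < n) `|realpart (1 * a i)| + \sum_(i < n) `|realpart (w * a i)|.
    by rewrite -big_split/= ler_sum// => i _; rewrite mul1r.
  have [h|h] := leP (\sum_(i < n) `|realpart (w * a i)|) (\sum_(i < n) `|realpart (1 * a i)|).
    by exists 1; rewrite ?rnorm1//; lra.
  by exists w => //; lra.
pose th i := 0 <= realpart (v * a i).
have [f f1 fth] := ind n th; have [g g1 gth] := ind n (fun i => ~~ th i).
pose sg i : K := (-1) ^+ (~~ th i).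
pose er i : K := dual_fun f (x i) - dual_fun g (x i) - sg i * (p - q).
have erP i : (i < n)%N -> rnorm (er i : K^o) <= 2 * r.
  move=> ni; have := rnormB (dual_fun f (x i) - (if th i then p else q) : K^o)
    (dual_fun g (x i) - (if ~~ th i then p else q)).
  have -> : dual_fun f (x i) - (if th i then p else q) -
      (dual_fun g (x i) - (if ~~ th i then p else q)) = er i.
    by rewrite /er /sg; case: (th i) => /=; ring.
  by have := fth i ni; have := gth i ni; lra.
have fgE : dual_fun f u - dual_fun g u =
    (\sum_(i < n) sg i * a i) * (p - q) + \sum_(i < n) a i * er i.
  rewrite /u !dual_fun_sum -sumrB mulr_suml -big_split/=; apply: eq_bigr => i _.
  by rewrite /er; ring.
have main : S / 2 <= rnorm (\sum_(i < n) sg i * a i : K^o).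
  have -> : rnorm (\sum_(i < n) sg i * a i : K^o) =
      rnorm (v * \sum_(i < n) sg i * a i : K^o) by rewrite rnormM v1 mul1r.
  apply: (le_trans _ (realpart_le_rnorm _)); rewrite ler_pdivrMr// mulrC.
  apply: (le_trans vS); rewrite ler_pM2l// mulr_sumr raddf_sum ler_sum// => i _.
  rewrite mulrCA /sg /th; case: (leP 0 (realpart (v * a i))) => h /=.
    by rewrite ?expr0 mul1r ger0_norm.
  by rewrite ?expr1 mulN1r raddfN/= ltr0_norm.
have err : rnorm (\sum_(i < n) a i * er i : K^o) <= 2 * r * S.
  apply: (le_trans (@rnorm_sum R k K^o n (fun i => a i * er i))).
  rewrite mulr_sumr ler_sum// => i _.
  by rewrite rnormM mulrC ler_wpM2r ?rnorm_ge0 ?erP.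
have fu := f1 u; have gu := g1 u.
have := rnormB (dual_fun f u) (dual_fun g u).
rewrite fgE; set P := _ * (p - q); set Er := \sum_(i < n) a i * er i.
have := rnormB (P + Er : K^o) Er; rewrite addrK {1}/P rnormM -/Er.
have S0 : 0 <= S by apply: sumr_ge0 => i _; exact: rnorm_ge0.
have S2 : 0 <= S / 2 by rewrite divr_ge0.
have := ler_pM S2 (_ : 0 <= 14 * r) main pq; rewrite mulr_ge0 ?(ltW r0)// => /(_ isT).
by move: err; rewrite -/Er; lra.
Qed.

(** Rosenthal's l1 theorem, in Dor's form covering complex scalars. If no
   subsequence is weakly Cauchy, then every subsequence oscillates along some
   functional, and its oscillation is witnessed by one of countably many pairs of
   small discs, taken from finite nets at the scales [1 / j]. A diagonal argument
   makes the pair the same for all further subsequences, and then independence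
   applies. *)
Theorem rosenthal_l1 (x : nat -> X) B : (forall n, rnorm (x n) <= B) ->
  (exists2 t, branch setT t & weakly_cauchy (x \o t)) \/
  (exists2 t, branch setT t & l1_sequence (x \o t)).
Proof.
move=> xB.
have [[t bt wt]|nW] := pselect (exists2 t, branch setT t & weakly_cauchy (x \o t)).
  by left; exists t.
right; pose rr j : R := (16 * j.+1%:R)^-1.
have rr0 j : 0 < rr j by rewrite invr_gt0 mulr_gt0 ?ltr0n.
have [net netP] : {net : nat -> seq K & forall j (a : K), rnorm (a : K^o) <= B ->
    exists2 b, b \in net j & rnorm (a - b : K^o) <= rr j}.
  apply: (@choice _ _ (fun j s => forall a : K, rnorm (a : K^o) <= B ->
    exists2 b, b \in s & rnorm (a - b : K^o) <= rr j)) => j.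
  exact: scalar_net.
pose disc j p m (f : dual X) :=
  bounded_by 1 f /\ rnorm (dual_fun f (x m) - nth 0 (net j) p : K^o) <= rr j.
pose V (i : nat * nat * nat) D := let: (j, p, q) := i in
  14 * rr j <= rnorm (nth 0 (net j) p - nth 0 (net j) q : K^o) /\
  exists f, inf_set [set m | D m /\ disc j p m f] /\
            inf_set [set m | D m /\ disc j q m f].
have oscillation D : inf_set D -> exists i, V i D.
  move=> iD; have [N bN _] := thin_branch (fun=> 0%N) iD.
  have [f [f1 [e [e0 fe]]]] : exists f : dual X, bounded_by 1 f /\ exists e, 0 < e /\
      forall N0, exists m n, [/\ (N0 <= m)%N, (N0 <= n)%N &
        e <= rnorm (dual_fun f (x (N m)) - dual_fun f (x (N n)))].
    apply: contrapT => nf; apply: nW; exists N; first by split=> //; exact: bN.1.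
    apply: dual_cauchy => f f1 e e0; apply: contrapT => nN; apply: nf.
    exists f; split=> //; exists e; split=> // N0; apply: contrapT => nmn.
    apply: nN; exists N0 => m n Nm Nn; rewrite ltNge; apply/negP => le.
    by apply: nmn; exists m, n.
  pose j := Num.truncn e^-1.
  have rje : 16 * rr j <= e.
    rewrite /rr invfM mulrA divff// mul1r -[leRHS]invrK.
    rewrite ler_pV2 ?inE ?unitfE ?gt_eqF ?invr_gt0 ?ltr0n//.
    exact: ltW (truncnS_gt _).
  have [b bP] : {b : nat -> nat & forall p, inf_set [set m | D m /\ disc j p m f] \/
      forall m, (b p <= m)%N -> ~ (D m /\ disc j p m f)}.
    apply: (@choice _ _ (fun p b => inf_set [set m | D m /\ disc j p m f] \/
      forall m, (b <= m)%N -> ~ (D m /\ disc j p m f))) => p.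
    have [io|nio] := pselect (inf_set [set m | D m /\ disc j p m f]).
      by exists 0%N; left.
    have [b bP] : exists b, forall m, (b <= m)%N -> ~ (D m /\ disc j p m f).
      apply: contrapT => nb; apply: nio => b; apply: contrapT => nm; apply: nb.
      by exists b => m bm Dm; apply: nm; exists m.
    by exists b; right.
  have [m [n [Nm Nn emn]]] := fe (\max_(p < size (net j)) b p).
  have hit l : (\max_(p < size (net j)) b p <= l)%N -> exists p,
      inf_set [set m | D m /\ disc j p m f] /\ disc j p (N l) f.
    move=> Nl; have [|c cn fc] := netP j (dual_fun f (x (N l))).
      by rewrite (le_trans (f1 _))// mul1r.
    pose p := index c (net j); have pn : (p < size (net j))%N by rewrite index_mem.
    have dp : disc j p (N l) f by split=> //; rewrite nth_index.
    exists p; split=> //; case: (bP p) => // /(_ (N l)) [|].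
      apply: (leq_trans _ (branch_ge l bN)); apply: leq_trans Nl.
      exact: (leq_bigmax (Ordinal pn)).
    by split=> //; exact: bN.2.
  have [p [iop [_ dp]]] := hit m Nm; have [q [ioq [_ dq]]] := hit n Nn.
  exists (j, p, q); split; last by exists f.
  have := rnormB (dual_fun f (x (N m)) - nth 0 (net j) p : K^o)
                 (dual_fun f (x (N n)) - nth 0 (net j) q).
  have := rnormD (nth 0 (net j) p - nth 0 (net j) q : K^o)
    (dual_fun f (x (N m)) - nth 0 (net j) p - (dual_fun f (x (N n)) - nth 0 (net j) q)).
  have -> : nth 0 (net j) p - nth 0 (net j) q +
    (dual_fun f (x (N m)) - nth 0 (net j) p - (dual_fun f (x (N n)) - nth 0 (net j) q)) =
    dual_fun f (x (N m)) - dual_fun f (x (N n)) by ring.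
  by lra.
have Vsub i D M p : (forall n, (p <= n)%N -> D n -> M n) -> V i D -> V i M.
  case: i => -[j p1 q1] DM [val [f [fp fq]]]; split=> //; exists f.
  by split=> n; [have [m] := fp (maxn n p)|have [m] := fq (maxn n p)];
    rewrite geq_max => /andP[nm pm] [Dm dm]; exists m => //; split=> //; exact: DM.
have [i [M [iM VM]]] : exists i M, inf_set M /\
    forall M', M' `<=` M -> inf_set M' -> V i M'.
  apply: contrapT => niM.
  have [|i M iM||D [_ iD VD]] := @diagonal (nat * nat * nat)%type (fun i D => ~ V i D) _ _ setT.
  - by move=> i M D p nV DM iD VD; apply: nV; exact: Vsub DM VD.
  - apply: contrapT => nD; apply: niM; exists i, M; split=> // M' M'M iM'.
    by apply: contrapT => nV; apply: nD; exists M'.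
  - by move=> n; exists n.
  by have [i /VD] := oscillation D iD.
case: i VM => -[j p] q VM; have [val _] := VM M (fun _ => id) iM.
have [|t bt tP] := @independent_pairs _ (disc j p) (disc j q) M iM.
  by move=> M' M'M iM'; have [_] := VM M' M'M iM'.
exists t; first by split=> // i; exact: bt.1.
have B0 : 0 <= B by rewrite (le_trans _ (xB 0%N))// rnorm_ge0.
have r0 := rr0 j; have lower n (a : nat -> K) :
    5 * rr j * \sum_(i < n) rnorm (a i : K^o) <=
    2 * rnorm (\sum_(i < n) a i *: x (t i)).
  (* One more index ensures that some index is available to bound [f]. *)
  apply: (l1_lower_bound (x := x \o t) r0 val) => {}n th.
  have [f fP] := tP n.+1 th; exists f => [|i ni].
    by have := fP 0%N isT; case: (th 0%N) => -[].
  by have := fP i (ltnW ni); case: (th i) => -[].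
have L0 : 0 <= 2 / (5 * rr j) by rewrite divr_ge0 ?mulr_ge0 ?(ltW r0).
exists (1 + B + 2 / (5 * rr j)) => [|n a /=]; first by lra.
rewrite l1_norm_unit_vector -!EFinM !lee_fin; set S := \sum_(i < n) rnorm _.
have S0 : 0 <= S by apply: sumr_ge0 => i _; exact: rnorm_ge0.
split.
  rewrite ler_pdivrMl; last by lra.
  apply: (le_trans (rnorm_comb_le (x := x \o t) n a (fun i => xB (t i)))).
  by rewrite ler_wpM2r//; lra.
have := lower n a; rewrite -/S => low.
apply: (@le_trans _ _ (2 / (5 * rr j) * rnorm (\sum_(i < n) a i *: (x \o t) i))).
  by rewrite mulrAC ler_pdivlMr ?mulr_gt0// mulrC.
by rewrite ler_wpM2r ?rnorm_ge0//; lra.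
Qed.

End Rosenthal.

(** * Combinations of the summing basis *)

Section SummingBasis.
Context {R : realType} {k : scalar_kind}.
Local Notation K := (scalars R k).

Definition tail_sum n (b : nat -> K) l : K := \sum_(i < n) b i * (l <= i)%:R.

Lemma summing_combE n (b : nat -> K) l :
  (\sum_(i < n) b i *: @summing_vector R k i) l = tail_sum n b l.
Proof.
have sE i : @summing_vector R k i l = (l <= i)%:R :> K.
  rewrite /summing_vector fct_sumE; elim: i => [|i IH].
    by rewrite big_ord1 /unit_vector leqn0.
  rewrite big_ord_recr/= IH /unit_vector.
  case: (ltngtP l i.+1) => h /=.
  - by rewrite -ltnS h addr0.
  - by rewrite leqNgt (ltnW h) addr0.
  - by rewrite h ltnn add0r.
rewrite fct_sumE /tail_sum; apply: eq_bigr => i _.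
by rewrite -sE.
Qed.

Lemma tail_sum_ge n (b : nat -> K) l : (n <= l)%N -> tail_sum n b l = 0.
Proof.
move=> nl; apply: big1 => i _.
by rewrite leqNgt (leq_trans (ltn_ord i) nl)/= mulr0.
Qed.

Lemma tail_sumB n (b : nat -> K) l : (l < n)%N ->
  tail_sum n b l - tail_sum n b l.+1 = b l.
Proof.
move=> ln; rewrite /tail_sum -sumrB (bigD1 (Ordinal ln))//= leqnn ltnn mulr1 mulr0 subr0.
rewrite big1 ?addr0// => i il; rewrite -mulrBr.
have /negPf il' : (i : nat) != l by apply: contra il => /eqP il; apply/eqP/val_inj.
by rewrite [(l < i)%N]ltn_neqAle eq_sym il'/= subrr mulr0.
Qed.

Lemma tail_sum_max n (b : nat -> K) : exists j, forall l,
  rnorm (tail_sum n b l : K^o) <= rnorm (tail_sum n b j : K^o).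
Proof.
case: (@Order.TotalTheory.arg_maxP _ _ 'I_n.+1 ord0 xpredT
  (fun i => rnorm (tail_sum n b i : K^o)) isT) => j _ jP; exists j => l.
have [ln|nl] := ltnP l n.+1; first exact: (jP (Ordinal ln)).
by rewrite (tail_sum_ge _ (ltnW nl)) (@rnorm0 R k K^o); exact: rnorm_ge0.
Qed.

(** By Abel summation, the sum is a combination of values of [a] whose weights are
   the increments of [c], nonnegative and of sum at most 1. *)
Lemma abel_bound (a : nat -> K) (c : nat -> R) A n :
  (forall i, rnorm (a i : K^o) <= A) -> (forall i, 0 <= c i <= 1) ->
  (forall i, c i <= c i.+1) -> a n = 0 ->
  rnorm (\sum_(i < n) (a i - a i.+1) * emb (c i) : K^o) <= A.
Proof.
move=> aA c01 cS an0.
have step m : rnorm (\sum_(i < m) (a i - a i.+1) * emb (c i) + a m * emb (c m) : K^o)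
    <= A * c m.
  elim: m => [|m IH].
    rewrite big_ord0 add0r rnormM rnorm_emb ger0_norm ?ler_wpM2r//.
      by case/andP: (c01 0%N).
    by case/andP: (c01 0%N).
  rewrite big_ord_recr/=.
  have -> : \sum_(i < m) (a i - a i.+1) * emb (c i) + (a m - a m.+1) * emb (c m) +
      a m.+1 * emb (c m.+1) = (\sum_(i < m) (a i - a i.+1) * emb (c i) + a m * emb (c m)) +
      a m.+1 * emb (c m.+1 - c m) by rewrite rmorphB/=; ring.
  apply: (le_trans (@rnormD R k K^o _ _)); rewrite rnormM rnorm_emb ger0_norm ?subr_ge0//.
  have : rnorm (a m.+1 : K^o) * (c m.+1 - c m) <= A * (c m.+1 - c m).
    by rewrite ler_wpM2r ?subr_ge0.
  by move: IH; set s := rnorm _; lra.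
have A0 : 0 <= A by rewrite (le_trans _ (aA 0%N))// rnorm_ge0.
have := step n; rewrite an0 mul0r addr0 => /le_trans; apply.
by case/andP: (c01 n) => _ c1; rewrite ler_piMr.
Qed.

Lemma sup_norm_summing n (b : nat -> K) j : (forall l,
    rnorm (tail_sum n b l : K^o) <= rnorm (tail_sum n b j : K^o)) ->
  sup_norm (\sum_(i < n) b i *: @summing_vector R k i) =
  (rnorm (tail_sum n b j : K^o))%:E.
Proof.
move=> jP; apply/eqP; rewrite eq_le; apply/andP; split.
  by apply: ge_ereal_sup => _ [l _ <-]; rewrite summing_combE lee_fin.
by apply: ereal_sup_ubound; exists j => //; rewrite summing_combE.
Qed.

End SummingBasis.

(** * Blocks of convex combinations *)

Section Blocks.
Context {R : realType} {k : scalar_kind}.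
Local Notation K := (scalars R k).
Variable X : normedModType K.
Variables (C : set X) (cC : rconvex C) (x y : nat -> X) (f : nat -> dual X) (eps : nat -> R).
Hypotheses (Cx : forall n, C (x n))
  (fx0 : forall i j, (i < j)%N -> dual_fun (f j) (x i) = 0)
  (fx1 : forall i j, (j <= i)%N -> rnorm (dual_fun (f j) (x i) - 1) <= eps i)
  (epsS : forall i j, (i <= j)%N -> eps j <= eps i)
  (xy : weakly_cvg (fun n => x n - \sum_(i < n.+1) y i) 0).

(** Properties, stable under convex combinations, of a convex combination [z] of
   terms [x n] with [N <= n < m], the same combination of the partial sums of
   [y] having coefficients [c]. *)
Definition block N m (z : X) (c : nat -> R) :=
  [/\ (N < m)%N, C z, forall l, 0 <= c l <= 1, forall l, (l <= N)%N -> c l = 1 &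
    [/\ forall l, (m <= l)%N -> c l = 0, forall j, (m <= j)%N -> dual_fun (f j) z = 0 &
      forall j, (j <= N)%N -> rnorm (dual_fun (f j) z - 1) <= eps N]].

Lemma block_leq N m m' z c : (m <= m')%N -> block N m z c -> block N m' z c.
Proof.
move=> mm' [Nm Cz c01 c1 [c0 fz0 fz1]]; split=> //; first exact: leq_trans mm'.
by split=> // l m'l; [apply: c0|apply: fz0]; exact: leq_trans m'l.
Qed.

Lemma block_comb N m z c z' c' s t : 0 <= s -> 0 <= t -> s + t = 1 ->
  block N m z c -> block N m z' c' ->
  block N m (emb s *: z + emb t *: z') (fun l => s * c l + t * c' l).
Proof.
move=> s0 t0 st [Nm Cz c01 c1 [c0 fz0 fz1]] [_ Cz' c01' c1' [c0' fz0' fz1']].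
split=> //; first exact: cC.
- move=> l; have /andP[h1 h2] := c01 l; have /andP[h3 h4] := c01' l.
  apply/andP; split; first by rewrite addr_ge0 ?mulr_ge0.
  have := ler_wpM2l s0 h2; have := ler_wpM2l t0 h4; lra.
- by move=> l lN; rewrite c1// c1'// !mulr1.
split=> [l ml|j mj|j jN].
- by rewrite c0// c0'// !mulr0 addr0.
- by rewrite dual_funD !dual_funZ fz0// fz0'// !mulr0 addr0.
rewrite dual_funD !dual_funZ.
have -> : emb s * dual_fun (f j) z + emb t * dual_fun (f j) z' - 1 =
    emb s * (dual_fun (f j) z - 1) + emb t * (dual_fun (f j) z' - 1).
  by rewrite !mulrBr !mulr1 addrACA -opprD -rmorphD/= st rmorph1.
apply: (le_trans (@rnormD R k K^o _ _)); rewrite !rnormM !rnorm_emb !ger0_norm//.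
by have := ler_wpM2l s0 (fz1 j jN); have := ler_wpM2l t0 (fz1' j jN); nra.
Qed.

(** Mazur's argument: the differences attached to blocks beyond [N] form a convex
   set with 0 in its weak closure, hence in its norm closure. *)
Lemma small_block N eta : 0 < eta -> exists m z c, block N m z c /\
  forall M, (m <= M)%N -> rnorm (z - \sum_(l < M) emb (c l) *: y l) <= eta.
Proof.
move=> eta0; apply: contrapT => nb.
pose D := [set w | exists m z c, block N m z c /\
  forall M, (m <= M)%N -> w = z - \sum_(l < M) emb (c l) *: y l].
have Dx n : (N < n.+1)%N -> D (x n - \sum_(i < n.+1) y i).
  move=> Nn; exists n.+1, (x n), (fun l => (l <= n)%:R); split.
    split=> //; first by move=> l; case: (l <= n)%N; rewrite /= ?lexx ?ler01.
      by move=> l lN; rewrite (leq_trans lN).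
    split=> [l nl|j nj|j jN]; first by rewrite leqNgt nl.
      exact: fx0.
    by rewrite (le_trans (fx1 _))// ?(leq_trans jN)// epsS.
  move=> M; elim: M => // M IH; rewrite leq_eqVlt => /predU1P[[<-]|].
    congr (_ - _); apply: eq_bigr => i _.
    by rewrite -ltnS ltn_ord rmorph1 scale1r.
  rewrite ltnS => nM; rewrite IH// big_ord_recr/= leqNgt nM/= rmorph0 scale0r.
  by rewrite addr0.
have cD : rconvex D.
  move=> w w' s t [m [z [c [bz wE]]]] [m' [z' [c' [bz' wE']]]] s0 t0 st.
  exists (maxn m m'), (emb s *: z + emb t *: z'), (fun l => s * c l + t * c' l).
  split.
    apply: block_comb => //; first exact: block_leq (leq_maxl _ _) bz.
    exact: block_leq (leq_maxr _ _) bz'.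
  move=> M; rewrite geq_max => /andP[mM m'M]; rewrite (wE M)// (wE' M)//.
  rewrite !scalerBr addrACA -opprD !scaler_sumr -big_split/=; congr (_ - _).
  by apply: eq_bigr => l _; rewrite rmorphD !rmorphM scalerDl !scalerA.
have Dbig w : D w -> eta <= rnorm w.
  move=> [m [z [c [bz wE]]]]; rewrite leNgt; apply/negP => w1; apply: nb.
  by exists m, z, c; split=> // M mM; rewrite -wE// ltW.
have [|g _ gD] := @separation _ _ X D eta _ cD Dbig.
  by exists (x N - \sum_(i < N.+1) y i); exact: Dx.
have [n0 _ nP] := cvg_weak g _ xy eta0.
have := nP (maxn n0 N) (leq_maxl _ _); rewrite /= dual_fun0 subr0 => h.
have := gD _ (Dx (maxn n0 N) _); rewrite ltnS leq_maxr => /(_ isT).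
by have := realpart_le_rnorm (dual_fun g (x (maxn n0 N) - \sum_(i < (maxn n0 N).+1) y i)); lra.
Qed.

End Blocks.

(** * Extraction of a summing basic sequence *)

(** The blocks [z i] are taken over successive intervals: [N i], the start of the
   i-th one, is the end [m] of the preceding one. Hence the coefficient [c i l] of
   [y l] increases with [i] from 0 to 1, as Abel summation requires. *)
Lemma summing_blocks (R : realType) (k : scalar_kind)
    (X : normedModType (scalars R k)) (C : set X) (x y : nat -> X)
    (f : nat -> dual X) (L : R) (eps : nat -> R) :
  rconvex C -> (forall n, C (x n)) -> (forall n, bounded_by L (f n)) ->
  (forall i j, (i < j)%N -> dual_fun (f j) (x i) = 0) ->
  (forall i j, (j <= i)%N -> rnorm (dual_fun (f j) (x i) - 1) <= eps i) ->
  (forall n, 0 < eps n) -> (forall i j, (i <= j)%N -> eps j <= eps i) ->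
  (forall n, \sum_(i < n) eps i <= 1 / 4) ->
  (forall g : dual X, (\sum_(0 <= n <oo) (rnorm (dual_fun g (y n)))%:E < +oo)%E) ->
  weakly_cvg (fun n => x n - \sum_(i < n.+1) y i) 0 ->
  exists z : nat -> X, (forall n, C (z n)) /\ c0_summing_basic_sequence z.
Proof.
move=> cC Cx fL fx0 fx1 eps0 epsS epssum wuc xy.
have [M M0 MP] := wuc_bound wuc.
pose t0 : nat * X * (nat -> R) := (0%N, 0, fun=> 0).
have [h|s sP] := @choice_history _ (fun h (t : nat * X * (nat -> R)) =>
  block C f eps (last t0 h).1.1 t.1.1 t.1.2 t.2 /\
  forall M, (t.1.1 <= M)%N ->
    rnorm (t.1.2 - \sum_(l < M) emb (t.2 l) *: y l) <= eps (size h)).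
  have [m [z [c zP]]] := small_block cC Cx fx0 fx1 epsS xy (last t0 h).1.1 (eps0 (size h)).
  by exists (m, z, c).
pose m i := (s i).1.1; pose z i := (s i).1.2; pose c i := (s i).2.
pose N i := if i is i'.+1 then m i' else 0%N.
have bz i : block C f eps (N i) (m i) (z i) (c i).
  by have [+ _] := sP i; case: i => // i; rewrite mkseqS last_rcons.
have near i K : (m i <= K)%N -> rnorm (z i - \sum_(l < K) emb (c i l) *: y l) <= eps i.
  by have [_ /(_ K)] := sP i; rewrite size_mkseq.
have NS i : (N i < N i.+1)%N by case: (bz i).
have Nmono : {mono N : i j / (i <= j)%N}.
  by apply: leq_mono; apply: homo_ltn => //; exact: ltn_trans.
have Nge i : (i <= N i)%N by elim: i => // i /leq_ltn_trans; apply.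
have fz0 i j : (i < j)%N -> dual_fun (f (N j)) (z i) = 0.
  by move=> ij; have [_ _ _ _ [_ + _]] := bz i; apply; rewrite -[m i]/(N i.+1) Nmono.
have fz1 i j : (j <= i)%N -> rnorm (dual_fun (f (N j)) (z i) - 1) <= eps i.
  move=> ji; have [_ _ _ _ [_ _ h]] := bz i.
  by apply: le_trans (epsS _ _ (Nge i)); apply: h; rewrite Nmono.
have c01 l i : 0 <= c i l <= 1 by case: (bz i).
have cS l i : c i l <= c i.+1 l.
  have [ml|lm] := leqP (m i) l.
    have [_ _ _ _ [-> // _ _]] := bz i.
    by case/andP: (c01 l i.+1).
  have [_ _ _ -> //] := bz i.+1; last exact: ltnW.
  by case/andP: (c01 l i).
exists z; split; first by move=> i; case: (bz i).
have L0 : 0 <= `|L| by [].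
exists (1 + M + 2 * `|L|) => [|n b u /=]; first by lra.
have [j jmax] := tail_sum_max n b.
rewrite (sup_norm_summing jmax) -!EFinM !lee_fin.
pose a := tail_sum n b; set A := rnorm (tail_sum n b j : (scalars R k)^o).
have aA l : rnorm (a l : (scalars R k)^o) <= A by exact: jmax.
have A0 : 0 <= A by exact: rnorm_ge0.
have bA i : (i < n)%N -> rnorm (b i : (scalars R k)^o) <= 2 * A.
  move=> ni; rewrite -(tail_sumB b ni).
  apply: (le_trans (@rnormB R k (scalars R k)^o _ _)).
  by have := aA i; have := aA i.+1; rewrite /a; lra.
have small (F : nat -> R) : (forall i, 0 <= F i) -> (forall i, (i < n)%N -> F i <= eps i) ->
    \sum_(i < n) rnorm (b i : (scalars R k)^o) * F i <= A / 2.
  move=> F0 Feps; apply: (@le_trans _ _ (\sum_(i < n) (2 * A) * eps i)).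
    by apply: ler_sum => i _; apply: ler_pM; rewrite ?rnorm_ge0 ?F0 ?bA ?Feps.
  rewrite -mulr_sumr; have A20 : 0 <= 2 * A by lra.
  by have := ler_wpM2l A20 (epssum n); lra.
split.
- rewrite ler_pdivrMl; last by lra.
  have uE : u = \sum_(i < n) b i *: (z i - \sum_(l < N n) emb (c i l) *: y l) +
      \sum_(l < N n) (\sum_(i < n) b i * emb (c i l)) *: y l.
    under [X in _ + X]eq_bigr do rewrite scaler_suml.
    rewrite exchange_big -big_split/=; apply: eq_bigr => i _.
    have -> : \sum_(l < N n) (b i * emb (c i l)) *: y l =
        b i *: \sum_(l < N n) emb (c i l) *: y l.
      by rewrite scaler_sumr; apply: eq_bigr => l _; rewrite scalerA.
    by rewrite -scalerDr subrK.
  have h1 : rnorm (\sum_(i < n) b i *: (z i - \sum_(l < N n) emb (c i l) *: y l)) <= A / 2.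
    apply: (le_trans (rnorm_sum n (fun i => b i *: (z i - \sum_(l < N n) emb (c i l) *: y l)))).
    under eq_bigr do rewrite rnormZ.
    apply: (small (fun i => rnorm (z i - \sum_(l < N n) emb (c i l) *: y l))) => i.
      exact: rnorm_ge0.
    by move=> ni; apply: near; rewrite -[m i]/(N i.+1) Nmono.
  have h2 : rnorm (\sum_(l < N n) (\sum_(i < n) b i * emb (c i l)) *: y l) <= M * A.
    apply: (MP (N n) (fun l => \sum_(i < n) b i * emb (c i l))) => // l _.
    rewrite (_ : \sum_(i < n) _ = \sum_(i < n) (a i - a i.+1) * emb (c i l)).
      by apply: (@abel_bound R k a (c ^~ l)) => //=; exact: tail_sum_ge.
    by apply: eq_bigr => i _; rewrite tail_sumB.
  rewrite uE; apply: (le_trans (rnormD _ _)).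
  have : 0 <= `|L| * A by rewrite mulr_ge0.
  by lra.
- have gu := fL (N j) u.
  have err : rnorm (dual_fun (f (N j)) u - a j : (scalars R k)^o) <= A / 2.
    rewrite /u dual_fun_sum /a /tail_sum -sumrB.
    pose e i : scalars R k := dual_fun (f (N j)) (z i) - (j <= i)%:R.
    have -> : \sum_(i < n) (b i * dual_fun (f (N j)) (z i) - b i * (j <= i)%:R) =
        \sum_(i < n) b i * e i by apply: eq_bigr => i _; rewrite /e mulrBr.
    apply: (le_trans (@rnorm_sum R k (scalars R k)^o n (fun i => b i * e i))).
    under eq_bigr do rewrite rnormM.
    apply: (small (fun i => rnorm (e i : (scalars R k)^o))) => i; first exact: rnorm_ge0.
    move=> _; rewrite /e; case: leqP => [ji|ij]; first exact: fz1.
    by rewrite fz0//= subrr rnorm0 ltW.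
  have := rnormB (dual_fun (f (N j)) u) (dual_fun (f (N j)) u - a j).
  rewrite subKr -[rnorm (a j : (scalars R k)^o)]/A => h.
  have := ler_wpM2r (rnorm_ge0 u) (ler_norm L).
  have : 0 <= (1 + M) * rnorm u by rewrite mulr_ge0 ?rnorm_ge0//; lra.
  by lra.
Qed.

Theorem lemma5p4 (R : realType) (k : scalar_kind)
    (X : completeNormedModType (scalars R k)) (C : set X) :
  property_u X -> bounded_closed_convex C ->
  weakly_compact C \/
  (exists x : nat -> X, (forall n, C (x n)) /\ l1_sequence x) \/
  (exists x : nat -> X, (forall n, C (x n)) /\ c0_summing_basic_sequence x).
Proof.
move=> propu bcC.
have [wC|nwC] := pselect (weakly_compact C); [by left|right].
pose eps n : R := (2 ^+ n.+3)^-1.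
have eps0 n : 0 < eps n by rewrite invr_gt0 exprn_gt0.
have epsSn n : eps n.+1 = eps n / 2 by rewrite /eps [in LHS]exprS invfM mulrC.
have epsS i j : (i <= j)%N -> eps j <= eps i.
  elim: j => [|j IH]; first by rewrite leqn0 => /eqP ->.
  rewrite leq_eqVlt => /predU1P[->//|/IH]; rewrite epsSn; have := eps0 j; lra.
have epssum n : \sum_(i < n) eps i <= 1 / 4.
  suff : \sum_(i < n) eps i = 1 / 4 - 2 * eps n by move=> ->; have := eps0 n; lra.
  elim: n => [|n IH]; last by rewrite big_ord_recr/= IH epsSn; lra.
  by rewrite big_ord0 /eps; field.
have [x [f [L [Cx fL fx0 fx1]]]] := james_sequence bcC nwC eps0.
have [_ /bounded_rnorm[B _ CB] _ /convex_set_rconvex cC] := bcC.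
have [[t bt wt]|[t bt l1]] := rosenthal_l1 (fun n => CB _ (Cx n)); last first.
  by left; exists (x \o t); split=> // n; exact: Cx.
right; have [y [wuc xy]] := propu _ wt.
apply: (@summing_blocks R k X C (x \o t) y (f \o t) L eps) => //.
- by move=> n; exact: Cx.
- by move=> n; exact: fL.
- by move=> i j ij; apply: fx0; exact: (branch_homo bt).
- move=> i j ji; apply: le_trans (epsS _ _ (branch_ge i bt)).
  by apply: fx1; rewrite (branch_mono bt).
Qed.
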